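(* Let $\mathfrak t$ be a semibounded sesquilinear form in a complex Hilbert space $\mathfrak H$. Then the following statements hold. (A) There exists a semibounded linear relation $S_{\mathfrak t}$ in $\mathfrak H$ which is bounded from below by $m(\mathfrak t)$, such that $\operatorname{dom}S_{\mathfrak t}\subset\operatorname{dom}\mathfrak t$ and for each $\{\varphi,\varphi'\}\in S_{\mathfrak t}$ $$\mathfrak t[\varphi,\psi]=(\varphi',\psi)\quad\text{for all}\quad\psi\in\operatorname{dom}\mathfrak t.\qquad(1)$$ If $H$ is any symmetric relation in $\mathfrak H$ such that $\operatorname{dom}H\subset\operatorname{dom}\mathfrak t$ and (1) holds for each $\{\varphi,\varphi'\}\in H$, then $H\subset S_{\mathfrak t}$. (B) There exists a semibounded selfadjoint extension $\widetilde A_{\mathfrak t}$ of $S_{\mathfrak t}$ in $\mathfrak H$ which is bounded from below by $m(\mathfrak t)$, such that for each $\{\varphi,\varphi'\}\in\widetilde A_{\mathfrak t}$ there exists a sequence $\varphi_n\in\operatorname{dom}\mathfrak t$ for which $$\varphi_n\to_{\mathfrak t}\varphi\quad\text{and}\quad\mathfrak t[\varphi_n,\psi]\to(\varphi',\psi)\quad\text{for all}\quad\psi\in\operatorname{dom}\mathfrak t.\qquad(2)$$ If $H$ is any selfadjoint relation in $\mathfrak H$ such that for each $\{\varphi,\varphi'\}\in H$ there exists a sequence $\varphi_n\in\operatorname{dom}\mathfrak t$ for which (2) holds, then $H=\widetilde A_{\mathfrak t}$. (C) For all $c\le m(\mathfrak t)$ the symmetric relation $S_{\mathfrak t}$ and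 the selfadjoint relation $\widetilde A_{\mathfrak t}$ admit the representations $$S_{\mathfrak t}=Q_c^*Q_c+c\quad\text{and}\quad\widetilde A_{\mathfrak t}=Q_c^*Q_c^{**}+c,$$ where $Q_c$ is a representing map for $\mathfrak t-c$. In particular, the relations $S_{\mathfrak t}$ and $\widetilde A_{\mathfrak t}$ do not depend on the choice of $c\le m(\mathfrak t)$ and the representing map $Q_c$.
   Context: A (sesquilinear) form $\mathfrak t$ in $\mathfrak H$ is a map $\operatorname{dom}\mathfrak t\times\operatorname{dom}\mathfrak t\to\mathbb C$, linear in the first and antilinear in the second entry, where $\operatorname{dom}\mathfrak t$ is a (not necessarily dense) linear subspace of $\mathfrak H$; $\mathfrak t[\varphi]=\mathfrak t[\varphi,\varphi]$. It is semibounded if there is $c\in\mathbb R$ with $\mathfrak t[\varphi]\ge c\|\varphi\|^2$ on $\operatorname{dom}\mathfrak t$; the greatest such $c$ is the lower bound $m(\mathfrak t)\in\mathbb R$ (so $\operatorname{dom}\mathfrak t\ne\{0\}$ is understood). No closedness or closability of $\mathfrak t$ is assumed. For $\varphi_n\in\operatorname{dom}\mathfrak t$ and $\varphi\in\mathfrak H$, $\varphi_n\to_{\mathfrak t}\varphi$ means $\varphi_n\to\varphi$ in $\mathfrak H$ and $\mathfrak t[\varphi_n-\varphi_m]\to0$. For $c\le m(\mathfrak t)$, a representing map for $\mathfrak t-c$ is a linear operator $Q_c$ from $\mathfrak H$ to some Hilbert space $\mathfrak K$ with $\operatorname{dom}Q_c=\operatorname{dom}\mathfrak t$ and $\mathfrak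 t[\varphi,\psi]-c(\varphi,\psi)=(Q_c\varphi,Q_c\psi)_{\mathfrak K}$ for $\varphi,\psi\in\operatorname{dom}\mathfrak t$; it always exists. A linear relation $T$ from $\mathfrak H$ to $\mathfrak K$ is a linear subspace of $\mathfrak H\times\mathfrak K$; operators are identified with their graphs, and ''in $\mathfrak H$'' means $\mathfrak K=\mathfrak H$. $\operatorname{dom}T=\{f:\{f,g\}\in T\text{ for some }g\}$. The adjoint is $T^*=\{\{k,h\}\in\mathfrak K\times\mathfrak H:(h,f)_{\mathfrak H}=(k,g)_{\mathfrak K}\text{ for all }\{f,g\}\in T\}$, and $T^{**}$ is the closure of $T$. Products: $RT=\{\{f,h\}:\{f,g\}\in T,\ \{g,h\}\in R\text{ for some }g\}$; for $c\in\mathbb R$ and $T$ in $\mathfrak H$, $T+c=\{\{f,g+cf\}:\{f,g\}\in T\}$. A relation $T$ in $\mathfrak H$ is symmetric if $T\subset T^*$, selfadjoint if $T=T^*$, and bounded from below by $c\in\mathbb R$ if $(f',f)\ge c\|f\|^2$ for all $\{f,f'\}\in T$; semibounded means bounded from below by some $c\in\mathbb R$. *)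

(* Defs.v *)
From HB Require Import structures.
From mathcomp Require Import all_boot all_order all_algebra complex.
From mathcomp Require Import all_classical all_reals all_analysis.
Set Implicit Arguments.
Unset Strict Implicit.
Unset Printing Implicit Defensive.
Import Order.TTheory GRing.Theory Num.Theory.
Import numFieldNormedType.Exports.
Local Open Scope classical_set_scope.
Local Open Scope ring_scope.

(* The scalars are kept as an arbitrary numClosedFieldType C, because the library
   provides the norm topology for those but not for the concrete type R[i].
   The complex Hilbert spaces are the elements of hilbertType R[i], R : realType.
   The inner product is linear in the first and antilinear in the second
   argument. *)
HB.mixin Record CompleteNormedModule_isHilbert (C : numClosedFieldType) (V : Type)
    of CompleteNormedModule C V := {
  inner : {dot V for (@Num.conj C)} ;
  inner_norm : forall x : V, inner x x = `|x| ^+ 2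
}.

#[short(type="hilbertType")]
HB.structure Definition Hilbert (C : numClosedFieldType) :=
  { V of CompleteNormedModule_isHilbert C V & CompleteNormedModule C V }.

Definition linear_subspace (K : nzRingType) (V : lmodType K) (D : set V) : Prop :=
  GRing.submod_closed [in D].

(* form_fun is a total function, but its values outside
   form_dom x form_dom are irrelevant. *)
Record sform (C : numClosedFieldType) (V : hilbertType C) := SForm {
  form_dom : set V ;
  form_fun :> V -> V -> C ;
  form_dom_linear : linear_subspace form_dom ;
  form_linearl : forall a x y z, form_dom x -> form_dom y -> form_dom z ->
    form_fun (a *: x + y) z = a * form_fun x z + form_fun y z ;
  form_antilinearr : forall a x y z, form_dom x -> form_dom y -> form_dom z ->
    form_fun z (a *: x + y) = a^* * form_fun z x + form_fun z y
}.

Section FormsRelations.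
Variable C : numClosedFieldType.
Implicit Types (V W X : hilbertType C) (c : C).

(* In C, a <= b means that b - a is a nonnegative real; for real c the
   inequality below forces t x x to be real. *)
Definition form_bounded_below V (t : sform V) c : Prop :=
  forall x, form_dom t x -> c * `|x| ^+ 2 <= t x x.

(* u_n ->_t x *)
Definition form_cvg V (t : sform V) (u : nat -> V) (x : V) : Prop :=
  [/\ forall n, form_dom t (u n),
      u @ \oo --> x &
      t (u nm.1 - u nm.2) (u nm.1 - u nm.2) @[nm --> (\oo, \oo)] --> (0 : C)].

(* x' represents t[x, -], respectively the limit of t[u_n, -] along some
   sequence u_n ->_t x. *)
Definition form_repr V (t : sform V) (x x' : V) : Prop :=
  forall y, form_dom t y -> t x y = inner x' y.

Definition form_limit_repr V (t : sform V) (x x' : V) : Prop :=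
  exists u : nat -> V, form_cvg t u x /\
    forall y, form_dom t y -> t (u n) y @[n --> \oo] --> (inner x' y : C).

Definition linear_relation V W (T : set (V * W)) : Prop := linear_subspace T.

Definition linear_operator V W (T : set (V * W)) : Prop :=
  linear_relation T /\
  forall f g g', T (f, g) -> T (f, g') -> g = g'.

Definition adjoint V W (T : set (V * W)) : set (W * V) :=
  [set kh | forall f g, T (f, g) -> inner kh.2 f = inner kh.1 g].

(* S T, i.e. first T, then S *)
Definition rel_mul V W X (S : set (W * X)) (T : set (V * W)) : set (V * X) :=
  [set fh | exists g, T (fh.1, g) /\ S (g, fh.2)].

(* T + c *)
Definition rel_shift V (T : set (V * V)) c : set (V * V) :=
  [set (fg.1, fg.2 + c *: fg.1) | fg in T].

Definition symmetric_relation V (T : set (V * V)) : Prop :=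
  linear_relation T /\ T `<=` adjoint T.

Definition selfadjoint_relation V (T : set (V * V)) : Prop :=
  linear_relation T /\ T = adjoint T.

Definition rel_bounded_below V (T : set (V * V)) c : Prop :=
  forall f f', T (f, f') -> c * `|f| ^+ 2 <= inner f' f.

Definition representing_map V W (t : sform V) c (Q : set (V * W)) : Prop :=
  [/\ linear_operator Q, Q.`1 = form_dom t &
      forall x y qx qy, Q (x, qx) -> Q (y, qy) ->
        t x y - c * inner x y = inner qx qy].

End FormsRelations.

Section RealBounds.
Variables (R : realType) (V : hilbertType R[i]).
Local Open Scope complex_scope.

Definition form_semibounded (t : sform V) : Prop :=
  exists c : R, form_bounded_below t c%:C.

Definition rel_semibounded (T : set (V * V)) : Prop :=
  exists c : R, rel_bounded_below T c%:C.

(* m(t): for t semibounded with nonzero domain the supremum is attained. *)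
Definition form_lower_bound (t : sform V) : R :=
  sup [set c : R | form_bounded_below t c%:C].

End RealBounds.

(* Main.v *)
(* Write [t - c = (Q -, Q -)] with a representing map [Q]. Unfolding the adjoint
   gives [Q^* Q + c = {(x, x') | x in dom t, t[x, -] = (x', -)}], and since
   [Q^**] is the set of limits of sequences in the graph of [Q],
   [Q^* Q^** + c] is exactly the set of pairs satisfying the limit condition
   (2).
   Both descriptions mention neither [c] nor [Q], which gives (C), and both
   relations contain every competitor; maximality of selfadjoint relations then
   turns the inclusion in (B) into an equality. Selfadjointness of [Q^* Q^**] is
   von Neumann's theorem: projecting [(h, 0)] onto the closed graph shows that
   [Q^* Q^** + 1] is onto, which suffices for a symmetric relation.
   The projection is found from a minimizing sequence in the graph.
   A representing map is the embedding of [dom t] in its completion for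
   [t - c], realized inside the functions on [dom t] as the pointwise limits of
   [t[u_n, -] - c (u_n, -)] along Cauchy sequences [u]. *)
Require Import Defs.
From HB Require Import structures.
From mathcomp Require Import all_boot all_order all_algebra complex.
From mathcomp Require Import ring.
From mathcomp Require Import all_classical all_reals all_analysis.
Set Implicit Arguments.
Unset Strict Implicit.
Unset Printing Implicit Defensive.
Import Order.TTheory GRing.Theory Num.Theory.
Import numFieldNormedType.Exports.
Local Open Scope classical_set_scope.
Local Open Scope ring_scope.

Lemma cvg_ext (T : Type) (W : nbhsType) (F : set_system T) (f g : T -> W)
    (l : W) : f =1 g -> f @ F --> l -> g @ F --> l.
Proof. by move=> /funext ->. Qed.

(** * Limits and order over the scalar field *)

Section FilterLimits.
Variable C : numClosedFieldType.

Lemma cvg_norm_le0 (T : Type) (F : set_system T) (W : normedModType C)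
    {FF : Filter F} (f : T -> W) (g : T -> C) :
  (forall x, `|f x| <= `|g x|) -> g @ F --> (0 : C) -> f @ F --> (0 : W).
Proof.
move=> fg /cvgr0Pnorm_lt g0; apply/cvgr0Pnorm_lt => e e0.
near=> x; apply: le_lt_trans (fg x) _.
by near: x; exact: g0.
Unshelve. all: by end_near. Qed.

Lemma cvg_normX0 (T : Type) (F : set_system T) (W : normedModType C)
    {FF : Filter F} (f : T -> W) :
  `|f x| ^+ 2 @[x --> F] --> (0 : C) -> f @ F --> (0 : W).
Proof.
move=> /cvgr0Pnorm_lt f0; apply/cvgr0Pnorm_lt => e e0.
near=> x.
rewrite -(@ltr_pXn2r _ 2) ?nnegrE ?normr_ge0 ?(ltW e0) //.
have -> : `|f x| ^+ 2 = `| `|f x| ^+ 2 |.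
  by rewrite ger0_norm ?exprn_ge0.
by near: x; apply: f0; rewrite exprn_gt0.
Unshelve. all: by end_near. Qed.

(** Eventually [f] coincides with [|f|], so [l] and [|l|] are limits of the same function. This
    avoids the order of [C], which is only partial. *)
Lemma cvg_ge0C (T : Type) (F : set_system T) {FF : ProperFilter F}
    (f : T -> C) (l : C) :
  (\forall x \near F, 0 <= f x) -> f @ F --> l -> 0 <= l.
Proof.
move=> f0 fl.
have fl' : `|f x| @[x --> F] --> `|l| by exact: cvg_norm.
have {}fl : `|f x| @[x --> F] --> l.
  apply: cvg_trans fl; apply: near_eq_cvg.
  by apply: filterS f0 => x /ger0_norm ->.
have -> : l = `|l| by exact: norm_cvg_unique fl fl'.
exact: normr_ge0.
Qed.

Lemma cvg_leC (T : Type) (F : set_system T) {FF : ProperFilter F}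
    (f g : T -> C) (l a : C) :
  (\forall x \near F, f x <= g x) ->
  f @ F --> l -> g @ F --> a -> l <= a.
Proof.
move=> fa fl ga; rewrite -subr_ge0.
have h : (g x - f x) @[x --> F] --> a - l by apply: cvgB.
by apply: cvg_ge0C h; apply: filterS fa => x; rewrite subr_ge0.
Qed.

End FilterLimits.

(** * Semi-inner products *)

Section SemiInner.
Variables (C : numClosedFieldType) (U : lmodType C).
Variable s : {hermitian U for false & (@Num.conj C)}.
Hypothesis s_ge0 : forall x, 0 <= s x x.

Lemma hermC_conj x y : s x y = (s y x)^*.
Proof. by rewrite hermC mul1r. Qed.

Lemma hermZl a x y : s (a *: x) y = a * s x y.
Proof. exact: linearZl_LR. Qed.

Lemma hermZr a x y : s x (a *: y) = a^* * s x y.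
Proof. exact: linearZr_LR. Qed.

Lemma hnormZ a x : s (a *: x) (a *: x) = `|a| ^+ 2 * s x x.
Proof. by rewrite hermZl hermZr mulrA normCK. Qed.

Lemma semi_CauchySchwarz x y : `|s x y| ^+ 2 <= s x x * s y y.
Proof.
have key a b : 0 <= `|a| ^+ 2 * s x x + `|b| ^+ 2 * s y y
    - (a * b^* * s x y + (a * b^* * s x y)^*).
  have := s_ge0 (a *: x - b *: y).
  rewrite hnormB mul1r !hnormZ hermZl hermZr /=.
  by rewrite !mulrA.
have [y0|yn0] := eqVneq (s y y) 0.
  rewrite y0 mulr0.
  have [->|xy0] := eqVneq (s x y) 0; first by rewrite normr0 expr0n.
  have n0 : 0 < `|s x y| ^+ 2 by rewrite exprn_gt0 // normr_gt0.
  (* When [s y y = 0], the inequality [key 1 (m * s x y)] says [0 <= s x x - 2 m |s x y|^2]; this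
     [m] makes the right side [- s x x - 2], a contradiction. *)
  pose m := (s x x + 1) / `|s x y| ^+ 2.
  have m0 : 0 <= m by rewrite divr_ge0 ?addr_ge0 // ltW.
  have := key 1 (m * s x y).
  rewrite y0 mulr0 addr0 normr1 expr1n !mul1r rmorphM /=.
  rewrite (CrealP _) ?ger0_real //.
  rewrite -mulrA (mulrC (s x y)^*) -normCK /m divfK ?gt_eqF //.
  rewrite (@CrealP _ (s x x + 1) _); last by rewrite ger0_real ?addr_ge0.
  move=> h; have /negP[] := negbT (le_gtF h).
  by rewrite subr_lt0 -addrA ltrDl ltr_wpDr ?addr_ge0 ?ltr01.
have y0 : 0 < s y y by rewrite lt_def yn0 s_ge0.
(* This instance is [s y y] times the claimed inequality. *)
have := key (s y y) (s x y).
rewrite (ger0_norm (s_ge0 _)) -(mulrA (s y y) _ (s x y)).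
rewrite (mulrC (s x y)^*) -normCK.
rewrite rmorphM /= (CrealP _) ?ger0_real //.
rewrite (CrealP _) ?rpredX ?normr_real // (mulrC (`|_| ^+ 2) (s y y)).
rewrite opprD addrA addrK expr2 -!mulrA -mulrBr pmulr_rge0 // subr_ge0.
by rewrite (mulrC (s y y)).
Qed.

(** By the parallelogram law the two sides differ by [s (x - y) (x - y)]. It replaces the triangle
    inequality in later estimates and keeps them free of square roots. *)
Lemma semi_hnormD_le x y : s (x + y) (x + y) <= 2 * (s x x + s y y).
Proof.
have := s_ge0 (x - y); rewrite hnormB hnormD => h.
by rewrite mulr_natl mulr2n lerD2l -subr_ge0.
Qed.

Lemma semi_triangle x y :
  sqrtC (s (x + y) (x + y)) <= sqrtC (s x x) + sqrtC (s y y).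
Proof.
rewrite -ler_sqr ?nnegrE ?addr_ge0 ?sqrtC_ge0 //.
rewrite sqrtCK sqrrD !sqrtCK hnormD mul1r [leRHS]addrAC lerD2l /=.
apply: (@le_trans _ _ (`|s x y| *+ 2)).
  rewrite (le_trans (real_ler_norm _)) //.
    by rewrite CrealE rmorphD /= conjCK addrC.
  by rewrite (le_trans (ler_normD _ _)) // norm_conjC mulr2n.
rewrite lerMn2r /= -ler_sqr ?nnegrE ?mulr_ge0 ?sqrtC_ge0 //.
by rewrite exprMn !sqrtCK semi_CauchySchwarz.
Qed.

End SemiInner.

(* The archimedean field is part of the structure because the filter-based
   completeness of [hilbert_carrier] is derived from it by a canonical
   instance. *)
Record inner_space (C : numClosedFieldType) := InnerSpace {
  inner_space_lmod :> lmodType C ;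
  inner_space_dot : {dot inner_space_lmod for (@Num.conj C)} ;
  inner_space_complete : forall u : nat -> inner_space_lmod,
    inner_space_dot (u nm.1 - u nm.2) (u nm.1 - u nm.2) @[nm --> (\oo, \oo)]
      --> (0 : C) ->
    exists l, inner_space_dot (u n - l) (u n - l) @[n --> \oo] --> (0 : C) ;
  inner_space_archi : (n.+1%:R : C)^-1 @[n --> \oo] --> (0 : C)
}.

(** * Hilbert spaces from complete inner product spaces *)

Section HilbertOfInner.
Variables (C : numClosedFieldType) (E : inner_space C).

(** An alias of [E] that carries the norm, its topology and the inner product as canonical
    structures. *)
Definition hilbert_carrier : Type := E.

HB.instance Definition _ := GRing.Lmodule.on hilbert_carrier.

Definition hilbert_norm (x : hilbert_carrier) : C :=
  sqrtC (inner_space_dot E x x).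

Lemma hilbert_normD x y :
  hilbert_norm (x + y) <= hilbert_norm x + hilbert_norm y.
Proof. by apply: semi_triangle => z; exact: dnorm_ge0. Qed.

Lemma hilbert_normZ a x : hilbert_norm (a *: x) = `|a| * hilbert_norm x.
Proof.
rewrite /hilbert_norm hnormZ sqrtCM ?nnegrE ?exprn_ge0 ?dnorm_ge0 //.
by rewrite sqrCK.
Qed.

Lemma hilbert_norm0_eq0 x : hilbert_norm x = 0 -> x = 0.
Proof. by move/eqP; rewrite sqrtC_eq0 dnorm_eq0 => /eqP. Qed.

HB.instance Definition _ := Lmodule_isNormed.Build C hilbert_carrier
  hilbert_normD hilbert_normZ hilbert_norm0_eq0.

(** From sequences to filters: for each [n] some ball of radius [1/(n+1)] around a point [u n]
    belongs to [F]. Two members of [F] intersect, so [u] is Cauchy, and its limit is the limit of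
    [F]. *)
Lemma hilbert_carrier_complete (F : set_system hilbert_carrier) :
  ProperFilter F -> cauchy F -> cvg F.
Proof.
move=> FF /cauchyP Fc.
have /choice[u uF] : forall n : nat, exists x, F (ball x n.+1%:R^-1).
  by move=> n; apply: Fc; rewrite invr_gt0.
have inv_ge0 n : 0 <= (n.+1%:R : C)^-1 by rewrite invr_ge0.
have u_near x n : ball (u n) n.+1%:R^-1 x -> `|u n - x| <= n.+1%:R^-1.
  by rewrite -ball_normE /= => /ltW.
have uu n m : `|u n - u m| <= n.+1%:R^-1 + m.+1%:R^-1.
  have [x [xn xm]] := filter_ex (filterI (uF n) (uF m)).
  rewrite (le_trans (ler_distD x _ _)) // lerD ?u_near // distrC.
  exact: u_near.
have normE (x : hilbert_carrier) : inner_space_dot E x x = `|x| ^+ 2.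
  by rewrite /Num.Def.normr /= /hilbert_norm sqrtCK.
have [l ul] : exists l, inner_space_dot E (u n - l) (u n - l)
    @[n --> \oo] --> (0 : C).
  apply: inner_space_complete.
  under eq_fun do rewrite normE.
  have inv_cvg := inner_space_archi E.
  have sum0 : (nm.1.+1%:R^-1 + nm.2.+1%:R^-1 : C) @[nm --> (\oo, \oo)]
      --> (0 : C).
    rewrite -[X in _ --> X]addr0; apply: cvgD.
      by apply: cvg_comp inv_cvg; exact: cvg_fst.
    by apply: cvg_comp inv_cvg; exact: cvg_snd.
  have sq0 : ((nm.1.+1%:R^-1 + nm.2.+1%:R^-1) ^+ 2 : C)
      @[nm --> (\oo, \oo)] --> (0 * 0 : C) by exact: cvgM.
  rewrite mulr0 in sq0.
  apply: cvg_norm_le0 sq0 => -[n m] /=.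
  rewrite !normrX ler_pXn2r ?nnegrE ?normr_ge0 // normr_id.
  by rewrite ger0_norm ?addr_ge0.
have {}ul : (u n - l) @[n --> \oo] --> (0 : hilbert_carrier).
  by apply: cvg_normX0; under eq_fun do rewrite -normE.
apply/cvg_ex; exists l; apply/cvgrPdist_lt => e e0.
have e20 : 0 < e / 2 by rewrite divr_gt0.
have n1 : \forall n \near \oo, `|u n - l| < e / 2.
  by exact: cvgr0_norm_lt ul _ e20.
have n2 : \forall n \near \oo, `|(n.+1%:R : C)^-1| < e / 2.
  by exact: cvgr0_norm_lt (inner_space_archi E) _ e20.
have n12 : \forall n \near \oo,
    `|u n - l| < e / 2 /\ `|(n.+1%:R : C)^-1| < e / 2.
  by apply: filterI.
have [n [{}n1 {}n2]] := filter_ex n12.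
have := uF n; apply: filterS => x /u_near xn.
rewrite (le_lt_trans (ler_distD (u n) _ _)) // (splitr e) ltrD //.
  by rewrite distrC.
by rewrite (le_lt_trans xn) // -(ger0_norm (inv_ge0 n)).
Qed.

HB.instance Definition _ := Uniform_isComplete.Build hilbert_carrier
  hilbert_carrier_complete.

Definition hilbert_dot (x y : hilbert_carrier) : C := inner_space_dot E x y.

Lemma hilbert_dot_bilinear :
  bilinear_for *%R ((@Num.conj C) \; *%R) hilbert_dot.
Proof.
split=> [z|z] a x y.
  exact: (linearPl (inner_space_dot E)).
exact: (linearPr (inner_space_dot E)).
Qed.

Lemma hilbert_dot_hermitian (x y : hilbert_carrier) :
  hilbert_dot x y = (-1) ^+ false * (hilbert_dot y x)^*.
Proof. exact: hermC. Qed.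

Lemma hilbert_dot_gt0 (x : hilbert_carrier) : x != 0 -> 0 < hilbert_dot x x.
Proof. by move=> x0; apply: (@neq0_dnorm_gt0 _ _ _ (inner_space_dot E)). Qed.

HB.instance Definition _ := @bilinear_isBilinear.Build C hilbert_carrier
  hilbert_carrier C *%R ((@Num.conj C) \; *%R) hilbert_dot hilbert_dot_bilinear.
HB.instance Definition _ := @isHermitianSesquilinear.Build C hilbert_carrier
  false (@Num.conj C) hilbert_dot hilbert_dot_hermitian.
HB.instance Definition _ := @isDotProduct.Build C hilbert_carrier
  hilbert_dot hilbert_dot_gt0.

Lemma hilbert_dot_norm (x : hilbert_carrier) : hilbert_dot x x = `|x| ^+ 2.
Proof. by rewrite /Num.Def.normr /= /hilbert_norm sqrtCK. Qed.

HB.instance Definition _ := CompleteNormedModule_isHilbert.Build C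
  hilbert_carrier hilbert_dot_norm.

Definition hilbert_of_inner : hilbertType C := hilbert_carrier.

End HilbertOfInner.

(** * Completion of a semi-inner product space *)

Section SubspaceType.
Variables (K : nzRingType) (U : lmodType K) (D : set U).
Hypothesis D_lin : linear_subspace D.

(** The proof of linearity is a parameter, so that the module structure can be attached to the
    type. *)
Definition subspace_type of linear_subspace D : Type := {x : U | x \in D}.
Local Notation T := (subspace_type D_lin).

HB.instance Definition _ := Choice.on T.
HB.instance Definition _ := [isSub of T for @sval _ _].
HB.instance Definition _ := GRing.SubChoice_isSubLmodule.Build K U [in D] T
  (GRing.submod_closed_semi D_lin).

Lemma subspace_typeP (x : T) : D (val x).
Proof. by have := valP x; rewrite inE. Qed.

Lemma subspace_type_ex (x : U) : D x -> exists y : T, val y = x.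
Proof. by move=> Dx; exists (exist _ x (mem_set Dx)). Qed.

End SubspaceType.

(** * Null and Cauchy sequences for a semi-inner product *)

Section SemiLimits.
Variables (C : numClosedFieldType) (E : lmodType C).
Variable s : {hermitian E for false & (@Num.conj C)}.
Hypothesis s_ge0 : forall x, 0 <= s x x.

Lemma semi_cvg0 (T : Type) (F : set_system T) {FF : Filter F}
    (f g : T -> E) (M : C) :
  0 <= M -> s (f x) (f x) @[x --> F] --> (0 : C) ->
  (\forall x \near F, s (g x) (g x) <= M) ->
  s (f x) (g x) @[x --> F] --> (0 : C).
Proof.
move=> M0 /cvgr0Pnorm_lt f0 gM; apply/cvgr0Pnorm_lt => e e0.
(* The bound is enlarged to a positive one, since it becomes a divisor and [M] may vanish. *)
have M1 : 0 < M + 1 by rewrite ltr_wpDl.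
have d0 : 0 < e ^+ 2 / (M + 1) by rewrite divr_gt0 ?exprn_gt0.
near=> x.
rewrite -(@ltr_pXn2r _ 2) ?nnegrE ?normr_ge0 ?(ltW e0) //.
rewrite (le_lt_trans (semi_CauchySchwarz s_ge0 _ _)) //.
apply: (@le_lt_trans _ _ (s (f x) (f x) * (M + 1))).
  rewrite ler_wpM2l // (@le_trans _ _ M) // ?lerDl //.
  by near: x; exact: gM.
rewrite -ltr_pdivlMr // -[ltLHS]ger0_norm //.
by near: x; exact: f0.
Unshelve. all: by end_near. Qed.

Definition semi_cauchy (u : nat -> E) : Prop :=
  s (u nm.1 - u nm.2) (u nm.1 - u nm.2) @[nm --> (\oo, \oo)] --> (0 : C).

Lemma semi_cvg0_lin (T : Type) (F : set_system T) {FF : Filter F}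
    (f g : T -> E) (a : C) :
  s (f x) (f x) @[x --> F] --> (0 : C) ->
  s (g x) (g x) @[x --> F] --> (0 : C) ->
  s (a *: f x + g x) (a *: f x + g x) @[x --> F] --> (0 : C).
Proof.
move=> f0 g0.
have h : (2 * (`|a| ^+ 2 * s (f x) (f x) + s (g x) (g x))) @[x --> F]
    --> (2 * (`|a| ^+ 2 * 0 + 0) : C).
  by apply: cvgMl_tmp; apply: cvgD => //; apply: cvgMl_tmp.
rewrite mulr0 addr0 mulr0 in h.
apply: cvg_norm_le0 h => x.
rewrite (ger0_norm (s_ge0 _)) -hnormZ (le_trans (semi_hnormD_le s_ge0 _ _)) //.
by rewrite ger0_norm // mulr_ge0 ?addr_ge0.
Qed.

Lemma semi_cauchy_lin a u v : semi_cauchy u -> semi_cauchy v ->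
  semi_cauchy (fun n => a *: u n + v n).
Proof.
move=> cu cv; apply: cvg_ext (semi_cvg0_lin a cu cv) => nm.
by rewrite scalerBr addrACA opprD.
Qed.

Lemma semi_cauchy_cst x : semi_cauchy (cst x).
Proof.
rewrite /semi_cauchy; under eq_fun do rewrite subrr linear0r.
exact: cvg_cst.
Qed.

Lemma semi_cauchy_near u e : semi_cauchy u -> 0 < e ->
  exists N, forall n m, (N <= n)%N -> (N <= m)%N ->
    s (u n - u m) (u n - u m) < e.
Proof.
move=> cu e0; have := cvgr0_norm_lt _ cu _ e0 => /(_ _).
move=> [[P Q] /= [[N1 _ PN] [N2 _ QN]] PQ].
exists (maxn N1 N2) => n m; rewrite !geq_max => /andP[n1 _] /andP[_ m2].
have := PQ (n, m) (conj (PN n n1) (QN m m2)).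
by rewrite /= ger0_norm.
Qed.

Lemma semi_cauchy_bounded u : semi_cauchy u ->
  exists2 M, 0 <= M & \forall n \near \oo, s (u n) (u n) <= M.
Proof.
move=> /semi_cauchy_near /(_ ltr01)[N uN].
exists (2 * (1 + s (u N) (u N))); first by rewrite mulr_ge0 ?addr_ge0.
exists N => // n /= Nn.
rewrite -[u n](subrK (u N)) (le_trans (semi_hnormD_le s_ge0 _ _)) //.
by rewrite ler_pM2l // lerD2r ltW // uN.
Qed.

End SemiLimits.

Lemma cvg_conjC (C : numClosedFieldType) (T : Type) (F : set_system T)
    {FF : Filter F} (f : T -> C) (l : C) :
  f @ F --> l -> (f x)^* @[x --> F] --> l^*.
Proof.
move=> /cvgrPdist_lt fl; apply/cvgrPdist_lt => e e0.
near=> x; rewrite -rmorphB /= norm_conjC.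
by near: x; exact: fl.
Unshelve. all: by end_near. Qed.

Lemma near_pair_fst (P : set nat) : (\forall n \near \oo, P n) ->
  \forall nm \near (\oo, \oo), P nm.1.
Proof.
by move=> h; exists (P, setT) => [|[n m] []//]; split=> //; exact: filterT.
Qed.

Lemma near_pair_snd (P : set nat) : (\forall n \near \oo, P n) ->
  \forall nm \near (\oo, \oo), P nm.2.
Proof.
by move=> h; exists (setT, P) => [|[n m] []//]; split=> //; exact: filterT.
Qed.

(* The library provides completeness, suprema and the archimedean property for
   a [realType] but not for [R[i]], and it declares no topology on the concrete
   type [R[i]]. The theory is thus developed over an abstract scalar field with
   these properties as hypotheses. *)
Definition seq_complete (C : numClosedFieldType) : Prop :=
  forall u : nat -> C,
    u nm.1 - u nm.2 @[nm --> (\oo, \oo)] --> (0 : C) -> cvg (u @ \oo).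

Section DenseIsometry.
Variables (C : numClosedFieldType) (E K : lmodType C).
Variables (s : {hermitian E for false & (@Num.conj C)}).
Variables (p : {hermitian K for false & (@Num.conj C)}).
Variable j : E -> K.
Hypothesis s_ge0 : forall x, 0 <= s x x.
Hypothesis p_ge0 : forall f, 0 <= p f f.
Hypothesis jB : forall x y, j (x - y) = j x - j y.
Hypothesis j_isometry : forall x y, p (j x) (j y) = s x y.
Hypothesis j_dense : forall f e, 0 < e -> exists x, p (j x - f) (j x - f) < e.
Hypothesis j_lim : forall u, semi_cauchy s u ->
  exists l, p (j (u n) - l) (j (u n) - l) @[n --> \oo] --> (0 : C).
Hypothesis C_archi : (n.+1%:R : C)^-1 @[n --> \oo] --> (0 : C).

(** Each [f n] is approximated within [1/(n+1)] by some [j (x n)]. As [j] is isometric, [x] is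
    Cauchy, and the limit of [j (x n)] is also that of [f]. *)
Lemma dense_complete (f : nat -> K) : semi_cauchy p f ->
  exists l, p (f n - l) (f n - l) @[n --> \oo] --> (0 : C).
Proof.
move=> cf.
have pC g h : p (g - h) (g - h) = p (h - g) (h - g) by rewrite -opprB hnormN.
have /choice[x xf] : forall n, exists x, p (j x - f n) (j x - f n) < n.+1%:R^-1.
  by move=> n; apply: j_dense; rewrite invr_gt0.
pose d n := p (j (x n) - f n) (j (x n) - f n).
have d0 : d n @[n --> \oo] --> (0 : C).
  apply: cvg_norm_le0 C_archi => n.
  by rewrite (ger0_norm (p_ge0 _)) ger0_norm ?invr_ge0 // ltW // xf.
have cx : semi_cauchy s x.
  (* A bound for [s (x n - x m) (x n - x m)], from passing through [f n] and [f m] between [j (x n)]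
     and [j (x m)]. *)
  have h : 2 * (d nm.1 + 2 * (p (f nm.1 - f nm.2) (f nm.1 - f nm.2) + d nm.2))
      @[nm --> (\oo, \oo)] --> (2 * (0 + 2 * (0 + 0)) : C).
    apply: cvgMl_tmp; apply: cvgD.
      by apply: cvg_comp d0; exact: cvg_fst.
    apply: cvgMl_tmp; apply: cvgD => //.
    by apply: cvg_comp d0; exact: cvg_snd.
  rewrite addr0 mulr0 addr0 mulr0 in h; apply: cvg_norm_le0 h => -[n m] /=.
  rewrite (ger0_norm (s_ge0 _)) -j_isometry.
  have -> : j (x n - x m) = (j (x n) - f n) + ((f n - f m) + (f m - j (x m))).
    by rewrite jB subrKA addrA subrK.
  rewrite (le_trans (semi_hnormD_le p_ge0 _ _)) //.
  rewrite [leRHS]ger0_norm ?mulr_ge0 ?addr_ge0 ?mulr_ge0 ?addr_ge0 ?p_ge0 //.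
  rewrite ler_pM2l // lerD2l /d (pC (j (x m))).
  exact: (semi_hnormD_le p_ge0).
have [l xl] := j_lim cx; exists l.
have h : 2 * (d n + p (j (x n) - l) (j (x n) - l)) @[n --> \oo]
    --> (2 * (0 + 0) : C) by apply: cvgMl_tmp; exact: cvgD.
rewrite addr0 mulr0 in h; apply: cvg_norm_le0 h => n.
rewrite (ger0_norm (p_ge0 _)) ger0_norm ?mulr_ge0 ?addr_ge0 ?p_ge0 //.
have -> : f n - l = (f n - j (x n)) + (j (x n) - l) by rewrite addrA subrK.
by rewrite /d (pC (j (x n))) (semi_hnormD_le p_ge0).
Qed.

End DenseIsometry.

Section Completion.
Variables (C : numClosedFieldType) (E : lmodType C).
Variable s : {hermitian E for false & (@Num.conj C)}.
Hypothesis s_ge0 : forall x, 0 <= s x x.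
Hypothesis C_complete : seq_complete C.
Hypothesis C_archi : (n.+1%:R : C)^-1 @[n --> \oo] --> (0 : C).

(** The increment of [s (u n) (v n)] splits into one term with a difference of [u] and one with a
    difference of [v]; both vanish because Cauchy sequences are bounded. The second term is
    conjugated to bring its vanishing factor into the first slot, as [semi_cvg0] requires. *)
Lemma semi_cauchy_form_cvg u v : semi_cauchy s u -> semi_cauchy s v ->
  cvg ((s (u n) (v n) : C) @[n --> \oo]).
Proof.
move=> cu cv; apply: C_complete.
have [M M0 uM] := semi_cauchy_bounded s_ge0 cu.
have [N N0 vN] := semi_cauchy_bounded s_ge0 cv.
have h1 : s (u nm.1 - u nm.2) (v nm.1) @[nm --> (\oo, \oo)] --> (0 : C).
  apply: (@semi_cvg0 _ _ _ s_ge0 _ _ _ (fun nm : nat * nat => u nm.1 - u nm.2)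
    (fun nm : nat * nat => v nm.1) _ N0) => //.
  exact: near_pair_fst vN.
have h2 : s (v nm.1 - v nm.2) (u nm.2) @[nm --> (\oo, \oo)] --> (0 : C).
  apply: (@semi_cvg0 _ _ _ s_ge0 _ _ _ (fun nm : nat * nat => v nm.1 - v nm.2)
    (fun nm : nat * nat => u nm.2) _ M0) => //.
  exact: near_pair_snd uM.
have h : s (u nm.1 - u nm.2) (v nm.1) + (s (v nm.1 - v nm.2) (u nm.2))^*
    @[nm --> (\oo, \oo)] --> (0 + 0^* : C).
  by apply: cvgD => //; exact: cvg_conjC.
rewrite conjC0 addr0 in h; apply: cvg_ext h => nm /=.
by rewrite -(hermC_conj s) linearBl linearBr /= addrA subrK.
Qed.

(** [u] represents the point [f] of the completion. With values in [C^o] the functions on [E] form a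
    module over [C], inside which the completion is a subspace. *)
Definition weak_limit (u : nat -> E) (f : E -> C^o) : Prop :=
  semi_cauchy s u /\ forall y, (s (u n) y : C) @[n --> \oo] --> (f y : C).

Lemma weak_limit_lin a u v f g : weak_limit u f -> weak_limit v g ->
  weak_limit (fun n => a *: u n + v n) (a *: f + g).
Proof.
move=> [cu uf] [cv vg]; split; first exact: semi_cauchy_lin.
move=> y; under eq_fun do rewrite linearDl /= (hermZl s).
by apply: cvgD; [apply: cvgMl_tmp; exact: uf | exact: vg].
Qed.

Lemma weak_limit_cst x : weak_limit (cst x) (s x).
Proof.
by split=> [|y]; [exact: semi_cauchy_cst | exact: (cvg_cst (s x y))].
Qed.

Lemma weak_limit_ex u : semi_cauchy s u -> exists f, weak_limit u f.
Proof.
move=> cu; exists (fun y => lim ((s (u n) y : C) @[n --> \oo])); split=> // y.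
exact: (semi_cauchy_form_cvg cu (semi_cauchy_cst s y)).
Qed.

(* Together with [weak_limit_form_unique], this makes the inner product of two
   functionals independent of the Cauchy sequences that define them. *)
Lemma weak_limit0_cvg u v : weak_limit u 0 -> semi_cauchy s v ->
  (s (u n) (v n) : C) @[n --> \oo] --> (0 : C).
Proof.
move=> [cu u0] cv; apply/cvgr0Pnorm_lt => e e0.
have e20 : 0 < e / 2 by rewrite divr_gt0.
have [M M0 uM] := semi_cauchy_bounded s_ge0 cu.
have h : s (v nm.1 - v nm.2) (u nm.1) @[nm --> (\oo, \oo)] --> (0 : C).
  apply: (@semi_cvg0 _ _ _ s_ge0 _ _ _ (fun nm : nat * nat => v nm.1 - v nm.2)
    (fun nm : nat * nat => u nm.1) _ M0) => //.
  exact: near_pair_fst uM.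
have := cvgr0_norm_lt _ h _ e20 => /(_ _).
move=> [[P Q] /= [[N1 _ PN] [N2 _ QN]] PQ].
have u1 : \forall n \near \oo, `|s (u n) (v N2)| < e / 2.
  by exact: cvgr0_norm_lt (u0 _) _ e20.
near=> n.
(* [v n] is split at the fixed vector [v N2]: the part with [v n - v N2] is small uniformly in large
   [n], and [s (u n) (v N2)] tends to 0. *)
rewrite -[v n](subrK (v N2)) linearDr (le_lt_trans (ler_normD _ _)) //.
rewrite (splitr e) ltrD //; last by near: n.
rewrite /= (hermC_conj s) norm_conjC.
apply: (PQ (n, N2)); split => /=; last by apply: QN => /=.
by apply: PN => /=; near: n; exists N1.
Unshelve. all: by end_near. Qed.

(** The differences [u' - u] and [v' - v] represent 0, so [weak_limit0_cvg] removes both error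
    terms. *)
Lemma weak_limit_form_unique u u' v v' f g (l : C) :
  weak_limit u f -> weak_limit u' f -> weak_limit v g -> weak_limit v' g ->
  (s (u n) (v n) : C) @[n --> \oo] --> l ->
  (s (u' n) (v' n) : C) @[n --> \oo] --> l.
Proof.
move=> uf u'f vg v'g uvl.
have diff0 w w' h : weak_limit w h -> weak_limit w' h ->
    weak_limit (fun n => w' n - w n) 0.
  move=> wh w'h; have := weak_limit_lin (-1) wh w'h.
  rewrite scaleN1r addrC subrr => -[cw w0].
  have wE : (fun n => -1 *: w n + w' n) = (fun n => w' n - w n).
    by apply/funext => n; rewrite scaleN1r addrC.
  split=> [|y]; first by rewrite -wE.
  by apply: cvg_ext (w0 y) => n; rewrite scaleN1r addrC.
have h1 := weak_limit0_cvg (diff0 _ _ _ uf u'f) v'g.1.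
have h2 := weak_limit0_cvg (diff0 _ _ _ vg v'g) uf.1.
have h : s (u' n - u n) (v' n) + (s (v' n - v n) (u n))^* + s (u n) (v n)
    @[n --> \oo] --> (0 + 0^* + l : C).
  by apply: cvgD => //; apply: cvgD => //; exact: cvg_conjC.
rewrite conjC0 addr0 add0r in h; apply: cvg_ext h => n /=.
by rewrite -(hermC_conj s) linearBl linearBr /= addrA !subrK.
Qed.

Definition weak_limits : set (E -> C^o) := [set f | exists u, weak_limit u f].

Lemma weak_limits_linear : linear_subspace weak_limits.
Proof.
split=> [|a f g]; rewrite !inE.
  exists (cst 0); have := weak_limit_cst 0; congr (weak_limit _ _).
  by apply/funext => y; rewrite linear0l.
by move=> [u uf] [v vg]; exists (fun n => a *: u n + v n);
  exact: weak_limit_lin.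
Qed.

Local Notation K := (subspace_type weak_limits_linear).

Lemma completion_repr (f : K) : exists u, weak_limit u (val f).
Proof. exact: (subspace_typeP f). Qed.

Definition completion_seq (f : K) : nat -> E := sval (cid (completion_repr f)).

Lemma completion_seqP f : weak_limit (completion_seq f) (val f).
Proof. exact: svalP (cid (completion_repr f)). Qed.

Definition completion_form (f g : K) : C :=
  lim ((s (completion_seq f n) (completion_seq g n) : C) @[n --> \oo]).

(** It frees the form from the chosen sequences [completion_seq]: any representing sequences may be
    used. *)
Lemma completion_form_cvg u v (f g : K) :
  weak_limit u (val f) -> weak_limit v (val g) ->
  (s (u n) (v n) : C) @[n --> \oo] --> completion_form f g.
Proof.
move=> uf vg.
apply: (weak_limit_form_unique (completion_seqP f) uf (completion_seqP g) vg).
exact: (semi_cauchy_form_cvg (completion_seqP f).1 (completion_seqP g).1).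
Qed.

Lemma completion_formE u v (f g : K) (l : C) :
  weak_limit u (val f) -> weak_limit v (val g) ->
  (s (u n) (v n) : C) @[n --> \oo] --> l -> completion_form f g = l.
Proof.
by move=> uf vg; apply: norm_cvg_unique; exact: completion_form_cvg.
Qed.

Lemma completion_form_hermitian (f g : K) :
  completion_form f g = (-1) ^+ false * (completion_form g f)^*.
Proof.
have fP := completion_seqP f; have gP := completion_seqP g.
rewrite mul1r; apply: (completion_formE fP gP).
under eq_fun do rewrite (hermC_conj s).
by apply: cvg_conjC; exact: completion_form_cvg.
Qed.

Lemma completion_form_linear (h : K) a (f g : K) :
  completion_form (a *: f + g) h =
  a * completion_form f h + completion_form g h.
Proof.
have fP := completion_seqP f; have gP := completion_seqP g.
have hP := completion_seqP h.
(* The sequence chosen for [a *: f + g] need not be this combination, but the combination represents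
   the same point. *)
have fgP : weak_limit (fun n => a *: completion_seq f n + completion_seq g n)
    (val (a *: f + g)) by rewrite linearP; exact: weak_limit_lin.
apply: (completion_formE fgP hP).
under eq_fun do rewrite linearDl /= (hermZl s).
by apply: cvgD; [apply: cvgMl_tmp|]; exact: completion_form_cvg.
Qed.

Lemma completion_form_bilinear :
  bilinear_for *%R ((@Num.conj C) \; *%R) completion_form.
Proof.
split=> h a f g; first exact: completion_form_linear.
rewrite completion_form_hermitian mul1r completion_form_linear.
rewrite rmorphD rmorphM /=; congr (_ * _ + _).
  by rewrite [RHS]completion_form_hermitian mul1r.
by rewrite [RHS]completion_form_hermitian mul1r.
Qed.

Lemma completion_form_ge0 f : 0 <= completion_form f f.
Proof.
have fP := completion_seqP f.
by apply: cvg_ge0C (completion_form_cvg fP fP); exact: nearW.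
Qed.

(** If the form vanishes at [f], then [s (u n) (u n)] tends to 0 along a representing sequence,
    hence by Cauchy-Schwarz so does [s (u n) y] for every [y]; its limit is [f y]. *)
Lemma completion_form_gt0 (f : K) : f != 0 -> 0 < completion_form f f.
Proof.
move=> f0; rewrite lt_def completion_form_ge0 andbT.
apply: contra f0 => /eqP ff.
have fP := completion_seqP f.
have := completion_form_cvg fP fP; rewrite ff => sf.
apply/eqP/val_inj/funext => y /=.
apply: (@norm_cvg_unique C C _ _ _ _ (fP.2 y)).
apply: (@semi_cvg0 _ _ _ s_ge0 _ _ _ (completion_seq f) (cst y) (s y y)) => //.
exact: nearW.
Qed.

HB.instance Definition _ := @bilinear_isBilinear.Build C K K C
  *%R ((@Num.conj C) \; *%R) completion_form completion_form_bilinear.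
HB.instance Definition _ := @isHermitianSesquilinear.Build C K
  false (@Num.conj C) completion_form completion_form_hermitian.
HB.instance Definition _ := @isDotProduct.Build C K
  completion_form completion_form_gt0.

Lemma completion_embedP x : weak_limits (s x).
Proof. by exists (cst x); exact: weak_limit_cst. Qed.

Definition completion_embed (x : E) : K :=
  exist (fun f : E -> C^o => f \in weak_limits) (s x)
    (mem_set (completion_embedP x)).

Lemma completion_embed_linear a x y :
  completion_embed (a *: x + y) = a *: completion_embed x + completion_embed y.
Proof.
apply: val_inj => /=; apply/funext => z.
by rewrite linearDl /= (hermZl s).
Qed.

Lemma completion_embed_cst x : weak_limit (cst x) (val (completion_embed x)).
Proof. exact: weak_limit_cst. Qed.

Lemma completion_embed_form x y :
  completion_form (completion_embed x) (completion_embed y) = s x y.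
Proof.
apply: (completion_formE (completion_embed_cst x) (completion_embed_cst y)).
exact: (cvg_cst (s x y)).
Qed.

(** For fixed [n] the difference is represented by [u n - u m] as [m] varies, so its form is a limit
    of values below [e / 2]; the halving restores the strict inequality lost in the limit. *)
Lemma completion_embed_cvg u (f : K) : weak_limit u (val f) ->
  completion_form (completion_embed (u n) - f) (completion_embed (u n) - f)
    @[n --> \oo] --> (0 : C).
Proof.
move=> uf; apply/cvgr0Pnorm_lt => e e0.
have e20 : 0 < e / 2 by rewrite divr_gt0.
have [N uN] := semi_cauchy_near s_ge0 uf.1 e20.
exists N => // n /= Nn; rewrite (ger0_norm (completion_form_ge0 _)).
apply: (@le_lt_trans _ _ (e / 2)); last first.
  by rewrite ltr_pdivrMr // ltr_pMr // ltr1n.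
have dP : weak_limit (fun m => -1 *: u m + u n)
    (val (completion_embed (u n) - f)).
  rewrite linearB /= addrC -(scaleN1r (val f)).
  by apply: weak_limit_lin => //; exact: completion_embed_cst.
have dl := completion_form_cvg dP dP.
apply: (cvg_leC _ dl (cvg_cst (e / 2))).
exists N => // m /= Nm.
by rewrite scaleN1r addrC ltW // uN.
Qed.

Lemma completion_embedB x y :
  completion_embed (x - y) = completion_embed x - completion_embed y.
Proof.
by rewrite addrC -scaleN1r completion_embed_linear scaleN1r addrC.
Qed.

Lemma completion_dense (f : K) e : 0 < e -> exists x,
  completion_form (completion_embed x - f) (completion_embed x - f) < e.
Proof.
move=> e0; have [u uf] := completion_repr f.
have fu : \forall m \near \oo, `|completion_form (completion_embed (u m) - f)
    (completion_embed (u m) - f)| < e.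
  by exact: cvgr0_norm_lt (completion_embed_cvg uf) _ e0.
have [m um] := filter_ex fu.
by exists (u m); rewrite -[ltLHS]ger0_norm ?completion_form_ge0.
Qed.

Lemma completion_embed_lim u : semi_cauchy s u -> exists l : K,
  completion_form (completion_embed (u n) - l) (completion_embed (u n) - l)
    @[n --> \oo] --> (0 : C).
Proof.
move=> cu; have [g ug] := weak_limit_ex cu.
have [l lg] : exists l : K, val l = g by apply: subspace_type_ex; exists u.
by exists l; apply: completion_embed_cvg; rewrite lg.
Qed.

Lemma completion_complete (f : nat -> K) :
  completion_form (f nm.1 - f nm.2) (f nm.1 - f nm.2) @[nm --> (\oo, \oo)]
    --> (0 : C) ->
  exists l, completion_form (f n - l) (f n - l) @[n --> \oo] --> (0 : C).
Proof.
exact: (dense_complete s_ge0 completion_form_ge0 completion_embedB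
  completion_embed_form completion_dense completion_embed_lim C_archi).
Qed.

Definition completion : inner_space C := @InnerSpace C K
  (completion_form : {dot K for (@Num.conj C)}) completion_complete C_archi.

End Completion.

Lemma completion_exists (C : numClosedFieldType) (E : lmodType C)
    (s : {hermitian E for false & (@Num.conj C)}) :
  (forall x, 0 <= s x x) -> seq_complete C ->
  (n.+1%:R : C)^-1 @[n --> \oo] --> (0 : C) ->
  exists (W : hilbertType C) (j : E -> W),
    (forall a x y, j (a *: x + y) = a *: j x + j y) /\
    forall x y, inner (j x) (j y) = s x y.
Proof.
move=> s_ge0 C_complete C_archi.
exists (hilbert_of_inner (completion s_ge0 C_complete C_archi)).
exists (completion_embed s_ge0); split.
  exact: completion_embed_linear.
exact: completion_embed_form.
Qed.

Lemma linear_subspaceP (K : nzRingType) (U : lmodType K) (D : set U) :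
  linear_subspace D <->
  D 0 /\ forall a x y, D x -> D y -> D (a *: x + y).
Proof.
split=> [[]|[D0 DP]].
  rewrite inE => D0 DP; split=> // a x y Dx Dy.
  by have := DP a x y; rewrite !inE; exact.
by split=> [|a x y]; rewrite !inE //; exact: DP.
Qed.

(** * Complex scalars *)

Section ComplexScalars.
Variable R : realType.
Local Open Scope complex_scope.

Lemma normc_real (k : R) : `|k%:C| = `|k|%:C.
Proof. by rewrite normc_def /= expr0n /= addr0 sqrtr_sqr. Qed.

Lemma normc_ge_Im (x : R[i]) : `|complex.Im x|%:C <= `|x|.
Proof.
rewrite normc_def lecR -sqrtr_sqr ler_wsqrtr // lerDr.
exact: sqr_ge0.
Qed.

Lemma normc_le_ReIm (x : R[i]) : `|x| <= (`|complex.Re x| + `|complex.Im x|)%:C.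
Proof.
rewrite {1}[x]complexE (le_trans (ler_normD _ _)) // normrM complexiE normCi.
by rewrite mul1r !normc_real -rmorphD.
Qed.

Lemma gtc0_real (e : R[i]) : 0 < e -> exists2 r : R, 0 < r & e = r%:C.
Proof.
by case: e => a b; rewrite ltcE /= => /andP[/eqP -> a0]; exists a.
Qed.

Lemma complex_archi :
  (n.+1%:R : (R[i] : numClosedFieldType))^-1 @[n --> \oo]
    --> (0 : R[i] : numClosedFieldType).
Proof.
apply/cvgr0Pnorm_lt => e /gtc0_real[r r0 ->].
have : \forall n \near \oo, `|(n.+1%:R : R)^-1| < r.
  by exact: cvgr0_norm_lt (@cvg_harmonic R) _ r0.
apply: filterS => n.
have -> : (n.+1%:R : R[i]) = (n.+1%:R)%:C by rewrite rmorph_nat.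
by rewrite -fmorphV normc_real ltcR.
Qed.

(** Real and imaginary parts do not increase the norm, so they are Cauchy in [R] and converge
    there. *)
Lemma complex_seq_complete : seq_complete R[i].
Proof.
move=> u /cvgr0Pnorm_lt cu.
have cvg_part (p : R[i] -> R) : (forall x y, p (x - y) = p x - p y) ->
    (forall x, `|p x|%:C <= `|x|) -> exists l : R, (p (u n)) @[n --> \oo] --> l.
  move=> pB p_le; apply/cvg_ex; apply: cauchy_cvg; apply/cauchy_ballP => e e0.
  have eC0 : (0 : R[i]) < e%:C by rewrite ltcR.
  have [[P Q] /= [nP nQ] PQ] := cu _ eC0.
  exists ((p \o u) @` P, (p \o u) @` Q) => /=.
    split; [apply: filterS nP|apply: filterS nQ] => n nn; by exists n.
  move=> [_ _] /= [[n Pn <-] [m Qm <-]].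
  rewrite -ball_normE /= -ltcR -pB; apply: le_lt_trans (p_le _) _.
  exact: (PQ (n, m)).
have [a ua] := cvg_part (@complex.Re R) (raddfB _) (@normc_ge_Re R).
have [b ub] := cvg_part (@complex.Im R) (raddfB _) normc_ge_Im.
apply/cvg_ex; exists (a +i* b); apply/cvgrPdist_lt => e /gtc0_real[r r0 ->].
have r20 : 0 < r / 2 by rewrite divr_gt0.
near=> n.
rewrite (le_lt_trans (normc_le_ReIm _)) // ltcR (splitr r) ltrD //.
  rewrite (raddfB (@complex.Re R)) /=.
  by near: n; move/cvgrPdist_lt : ua; apply.
rewrite (raddfB (@complex.Im R)) /=.
by near: n; move/cvgrPdist_lt : ub; apply.
Unshelve. all: by end_near. Qed.

End ComplexScalars.

(** The form of order completeness that provides the distance from a point to a subspace. *)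
Definition nonneg_inf (C : numClosedFieldType) : Prop :=
  forall A : set C, A !=set0 -> (forall a, A a -> 0 <= a) ->
  exists i, (forall a, A a -> i <= a) /\
    forall e, 0 < e -> exists2 a, A a & a < i + e.

Lemma complex_nonneg_inf (R : realType) : nonneg_inf R[i].
Proof.
move=> A [a0 Aa0] A0.
have A_real a : A a -> a = (complex.Re a)%:C%C.
  by move=> /A0; case: a => x y; rewrite lecE /= => /andP[/eqP -> _].
pose B := (@complex.Re R) @` A.
have B0 : has_inf B.
  split; first by exists (complex.Re a0), a0.
  by exists 0 => _ [a /A0 Aa <-]; move: Aa; rewrite lecE /= => /andP[].
exists (inf B)%:C%C; split=> [a Aa|e /gtc0_real[r r0 ->]].
  by rewrite (A_real a Aa) lecR; apply: ge_inf; [exact: B0.2|exists a].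
have [_ [a Aa <-] ar] := inf_adherent r0 B0.
by exists a => //; rewrite (A_real a Aa) -rmorphD /= ltcR.
Qed.

Lemma cauchy_seq_cvg (K : numFieldType) (W : completeNormedModType K)
    (u : nat -> W) :
  u nm.1 - u nm.2 @[nm --> (\oo, \oo)] --> (0 : W) -> cvg (u @ \oo).
Proof.
move=> /cvgr0Pnorm_lt cu; apply: cauchy_cvg; apply/cauchy_ballP => e e0.
have [[P Q] /= [nP nQ] PQ] := cu _ e0.
exists (u @` P, u @` Q) => /=.
  by split; [apply: filterS nP|apply: filterS nQ] => n nn; exists n.
move=> [_ _] /= [[n Pn <-] [m Qm <-]].
by rewrite -ball_normE /=; exact: (PQ (n, m)).
Qed.

(** * Orthogonal projection and von Neumann's theorem *)

Section MinimizingSequence.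
Variables (C : numClosedFieldType) (E : lmodType C).
Variable p : {hermitian E for false & (@Num.conj C)}.
Hypothesis p_ge0 : forall x, 0 <= p x x.
Hypothesis C_archi : (n.+1%:R : C)^-1 @[n --> \oo] --> (0 : C).
Hypothesis C_inf : nonneg_inf C.

(** The [u n] approach the infimum of the squared distances from [h] to [D]. The parallelogram law
    makes them Cauchy, and near-minimality makes [h - u n] asymptotically orthogonal to [D]. *)
Lemma minimizing_seq (D : set E) (h : E) : linear_subspace D ->
  exists u : nat -> E, [/\ forall n, D (u n), semi_cauchy p u &
    forall x, D x -> p (h - u n) x @[n --> \oo] --> (0 : C)].
Proof.
move=> /linear_subspaceP[D0 DP].
pose A := [set p (h - x) (h - x) | x in D].
have [i [i_le i_adh]] : exists i, (forall a, A a -> i <= a) /\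
    forall e, 0 < e -> exists2 a, A a & a < i + e.
  apply: C_inf => [|_ [x _ <-] //].
  by exists (p (h - 0) (h - 0)), 0.
have {}i_le x : D x -> i <= p (h - x) (h - x).
  by move=> Dx; apply: i_le; exists x.
have /choice[u uP] : forall n, exists x, D x /\
    p (h - x) (h - x) < i + n.+1%:R^-1.
  move=> n; have [|_ [x Dx <-] xi] := i_adh n.+1%:R^-1.
    by rewrite invr_gt0.
  by exists x.
have Du n : D (u n) by have [] := uP n.
have ui n : p (h - u n) (h - u n) < i + n.+1%:R^-1 by have [] := uP n.
have i_lt n : n.+1%:R^-1 >= (0 : C) by rewrite invr_ge0.
exists u; split=> //.
  have sum0 : 2 * (nm.1.+1%:R^-1 + nm.2.+1%:R^-1) @[nm --> (\oo, \oo)]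
      --> (2 * (0 + 0) : C).
    apply: cvgMl_tmp; apply: cvgD.
      by apply: cvg_comp C_archi; exact: cvg_fst.
    by apply: cvg_comp C_archi; exact: cvg_snd.
  rewrite addr0 mulr0 in sum0; apply: cvg_norm_le0 sum0 => -[n m] /=.
  rewrite (ger0_norm (p_ge0 _)) ger0_norm ?mulr_ge0 ?addr_ge0 //.
  (* The midpoint of [u n] and [u m] is again in [D]: parallelogram law. *)
  have mid : i *+ 4 <= p ((h - u n) + (h - u m)) ((h - u n) + (h - u m)).
    have -> : (h - u n) + (h - u m) = 2 *: (h - 2^-1 *: (u n + u m)).
      rewrite scalerBr scalerA divff ?pnatr_eq0 // scale1r scaler_nat mulr2n.
      by rewrite opprD addrACA.
    have -> : i *+ 4 = 2 ^+ 2 * i by rewrite -natrX mulr_natl.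
    rewrite hnormZ normr_nat ler_wpM2l ?exprn_ge0 //.
    apply: i_le; have Dnm : D (1 *: u n + u m) by exact: DP.
    by have := DP 2^-1 _ _ Dnm D0; rewrite addr0 scale1r.
  have para x y : p (x - y) (x - y) =
      2 * (p x x + p y y) - p (x + y) (x + y).
    by rewrite hnormB hnormD; ring.
  have -> : u n - u m = - ((h - u n) - (h - u m)).
    by rewrite opprB opprB [RHS]addrC subrKA.
  rewrite hnormN para lerBlDr (le_trans _ (lerD (lexx _) mid)) //.
  have -> : 2 * (n.+1%:R^-1 + m.+1%:R^-1) + i *+ 4 =
      2 * ((i + n.+1%:R^-1) + (i + m.+1%:R^-1)).
    by rewrite -mulr_natl; ring.
  by rewrite ler_pM2l // lerD // ltW.
move=> x Dx.
have P1 : 0 < p x x + 1 by rewrite ltr_wpDl.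
(* Moving [u n] by [p (h - u n) x / (p x x + 1)] times [x] cannot decrease the
   distance to [h] below the infimum. *)
apply: cvg_normX0.
have b0 : (p x x + 1) * n.+1%:R^-1 @[n --> \oo] --> ((p x x + 1) * 0 : C).
  exact: cvgMl_tmp.
rewrite mulr0 in b0; apply: cvg_norm_le0 b0 => n.
set a := p (h - u n) x.
rewrite normrX normr_id [leRHS]ger0_norm ?mulr_ge0 // ?(ltW P1) //.
pose t := (p x x + 1)^-1.
have t0 : 0 < t by rewrite invr_gt0.
have tP : t * p x x <= 1 by rewrite mulrC ler_pdivrMr // mul1r lerDl.
have tr : t^* = t by apply/CrealP; rewrite ger0_real // ltW.
have := i_le ((a * t) *: x + u n) (DP _ _ _ Dx (Du n)).
rewrite opprD addrCA addrC hnormB mul1r hnormZ (hermZr p) -/a => le1.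
pose N := `|a| ^+ 2.
have N0 : 0 <= N by rewrite exprn_ge0.
have crossE : (a * t)^* * a = t * N.
  by rewrite rmorphM /= tr /N normCK; ring.
have crossr : (t * N)^* = t * N.
  by apply/CrealP; rewrite ger0_real // mulr_ge0 // ltW.
rewrite crossE /= crossr normrM (ger0_norm (ltW t0)) exprMn -/N in le1.
(* The cross terms gain [2 t N] and the quadratic term costs at most [t N]. The remaining decrease
   [t N] is therefore below the excess [1/(n+1)] over the infimum. *)
have le2 : N * t ^+ 2 * p x x <= t * N.
  have -> : N * t ^+ 2 * p x x = t * N * (t * p x x) by ring.
  by rewrite ler_piMr // mulr_ge0 // ltW.
have le3 : i <= p (h - u n) (h - u n) - t * N.
  apply: (le_trans le1); rewrite -addrA lerD2l opprD addrA.
  by rewrite -[leRHS]add0r lerD2r subr_le0.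
have lt4 : t * N < n.+1%:R^-1.
  rewrite -(ltrD2l i); apply: le_lt_trans (ui n).
  by rewrite -lerBrDr.
by rewrite -ler_pdivrMl // ltW.
Qed.

End MinimizingSequence.

Section ProductForm.
Variables (C : numClosedFieldType) (V W : hilbertType C).

(** The inner product of the Hilbert space sum of [V] and [W], in which relations are subspaces. *)
Definition graph_form (x y : V * W) : C := inner x.1 y.1 + inner x.2 y.2.

Lemma graph_form_bilinear : bilinear_for *%R ((@Num.conj C) \; *%R) graph_form.
Proof.
split=> z a x y; rewrite /graph_form /=.
  rewrite !linearDl /= !(hermZl inner); ring.
rewrite !linearDr /= !(hermZr inner); ring.
Qed.

Lemma graph_form_hermitian (x y : V * W) :
  graph_form x y = (-1) ^+ false * (graph_form y x)^*.
Proof.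
by rewrite mul1r /graph_form rmorphD /= -!(hermC_conj inner).
Qed.

HB.instance Definition _ := @bilinear_isBilinear.Build C (V * W)%type
  (V * W)%type C *%R ((@Num.conj C) \; *%R) graph_form graph_form_bilinear.
HB.instance Definition _ := @isHermitianSesquilinear.Build C (V * W)%type
  false (@Num.conj C) graph_form graph_form_hermitian.

Lemma graph_form_ge0 x : 0 <= graph_form x x.
Proof. by rewrite /graph_form !inner_norm addr_ge0 ?exprn_ge0. Qed.

End ProductForm.

(** * Algebra and continuity of the inner product *)

Section HilbertBasics.
Variables (C : numClosedFieldType) (V : hilbertType C).
Implicit Types x y z : V.

Lemma inner_conj x y : inner x y = (inner y x)^*.
Proof. exact: (hermC_conj inner). Qed.

Lemma inner0l y : inner 0 y = 0 :> C. Proof. exact: linear0l. Qed.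

Lemma innerDl x y z : inner (x + y) z = inner x z + inner y z.
Proof. exact: linearDl. Qed.

Lemma innerBl x y z : inner (x - y) z = inner x z - inner y z.
Proof. exact: linearBl. Qed.

Lemma innerNl x y : inner (- x) y = - inner x y.
Proof. exact: linearNl. Qed.

Lemma innerZl a x y : inner (a *: x) y = a * inner x y.
Proof. exact: (hermZl inner). Qed.

Lemma innerDr x y z : inner x (y + z) = inner x y + inner x z.
Proof. exact: linearDr. Qed.

Lemma innerBr x y z : inner x (y - z) = inner x y - inner x z.
Proof. exact: linearBr. Qed.

Lemma innerNr x y : inner x (- y) = - inner x y.
Proof. exact: linearNr. Qed.

Lemma innerZr a x y : inner x (a *: y) = a^* * inner x y.
Proof. exact: (hermZr inner). Qed.

Lemma inner_ge0 x : 0 <= inner x x.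
Proof. by rewrite inner_norm exprn_ge0. Qed.

Lemma inner_eq0 x : inner x x = 0 -> x = 0.
Proof. by rewrite inner_norm => /eqP; rewrite sqrf_eq0 normr_eq0 => /eqP. Qed.

Lemma inner_norm_le x y : `|inner x y| <= `|x| * `|y|.
Proof.
rewrite -(@ler_pXn2r _ 2) ?nnegrE ?mulr_ge0 ?normr_ge0 //.
by rewrite exprMn -!inner_norm (semi_CauchySchwarz inner_ge0).
Qed.

Lemma cvg_inner (T : Type) (F : set_system T) {FF : Filter F} (f : T -> V)
    (l y : V) :
  f @ F --> l -> inner (f x) y @[x --> F] --> (inner l y : C).
Proof.
move=> fl.
have fl0 : f x - l @[x --> F] --> (0 : V).
  by rewrite -(subrr l); apply: cvgB => //; exact: cvg_cst.
have nfl : `|f x - l| * `|y| @[x --> F] --> (`|0 : V| * `|y| : C).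
  by apply: cvgMr_tmp; exact: cvg_norm.
rewrite normr0 mul0r in nfl.
have h : inner (f x - l) y @[x --> F] --> (0 : C).
  apply: cvg_norm_le0 nfl => x; rewrite [leRHS]ger0_norm ?mulr_ge0 //.
  exact: inner_norm_le.
have h2 : inner (f x - l) y + inner l y @[x --> F] --> (0 + inner l y : C).
  by apply: cvgD => //; exact: cvg_cst.
rewrite add0r in h2; apply: cvg_ext h2 => x.
by rewrite innerBl subrK.
Qed.

Lemma inner_cauchy_cvg (u : nat -> V) :
  inner (u nm.1 - u nm.2) (u nm.1 - u nm.2) @[nm --> (\oo, \oo)] --> (0 : C) ->
  cvg (u @ \oo).
Proof.
move=> cu; apply: cauchy_seq_cvg; apply: cvg_normX0.
by apply: cvg_ext cu => nm; rewrite inner_norm.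
Qed.

End HilbertBasics.

(** * Linear relations, adjoints and closures *)

Section LinearRelations.
Variables (C : numClosedFieldType) (V W : hilbertType C).
Implicit Types (Q : set (V * W)).

Lemma adjoint_linear Q : linear_relation (adjoint Q).
Proof.
apply/linear_subspaceP; split=> [f g _|a [x x'] [y y'] Qx Qy f g Qfg] /=.
  by rewrite !inner0l.
have /= hx := Qx _ _ Qfg; have /= hy := Qy _ _ Qfg.
by rewrite !innerDl !innerZl hx hy.
Qed.

Lemma sub_biadjoint Q : Q `<=` adjoint (adjoint Q).
Proof.
move=> [x y] Qxy f g /= fg.
by rewrite inner_conj -(fg _ _ Qxy) -inner_conj.
Qed.

(** The identity defining the second adjoint holds on [Q] and passes to the limit by continuity of
    the inner product. *)
Lemma biadjoint_lim Q (q : nat -> V * W) x y : (forall n, Q (q n)) ->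
  (q n).1 @[n --> \oo] --> x -> (q n).2 @[n --> \oo] --> y ->
  adjoint (adjoint Q) (x, y).
Proof.
move=> Qq qx qy f g /= fg.
apply: (@norm_cvg_unique C C _ _ _ _ (cvg_inner (y := f) qy)).
apply: cvg_ext (cvg_inner (y := g) qx) => n.
have := Qq n; rewrite [q n]surjective_pairing => /fg h.
by rewrite inner_conj h -inner_conj.
Qed.

Hypothesis C_archi : (n.+1%:R : C)^-1 @[n --> \oo] --> (0 : C).
Hypothesis C_inf : nonneg_inf C.

(** [(f, g)] is the orthogonal projection of [(h, k)] onto the closure of [Q]: a minimizing sequence
    for [graph_form] is Cauchy in each component, so both components converge. *)
Lemma graph_projection Q (h : V) (k : W) : linear_relation Q ->
  exists f g, exists q : nat -> V * W,
    [/\ forall n, Q (q n), (q n).1 @[n --> \oo] --> f,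
        (q n).2 @[n --> \oo] --> g &
        forall x y, Q (x, y) -> inner (h - f) x + inner (k - g) y = 0].
Proof.
move=> Ql.
have [q [Qq cq q0]] := minimizing_seq (@graph_form_ge0 C V W) C_archi C_inf
  (h, k) Ql.
have c1 : cvg ((q n).1 @[n --> \oo]).
  apply: inner_cauchy_cvg; apply: cvg_norm_le0 cq => nm.
  rewrite !ger0_norm ?graph_form_ge0 ?inner_ge0 //.
  by rewrite [leRHS]/(inner _ _ + inner _ _) lerDl inner_ge0.
have c2 : cvg ((q n).2 @[n --> \oo]).
  apply: inner_cauchy_cvg; apply: cvg_norm_le0 cq => nm.
  rewrite !ger0_norm ?graph_form_ge0 ?inner_ge0 //.
  by rewrite [leRHS]/(inner _ _ + inner _ _) lerDr inner_ge0.
exists (lim ((q n).1 @[n --> \oo])), (lim ((q n).2 @[n --> \oo])), q.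
split=> // x y Qxy.
have := q0 _ Qxy; apply: norm_cvg_unique.
rewrite /graph_form /=.
apply: cvgD; apply: cvg_inner; apply: cvgB => //; exact: cvg_cst.
Qed.

(** Let [(f, g)] be the projection of [(x, y)] onto the closure of [Q]. The residual is orthogonal
    to [Q], so [(y - g, - (x - f))] lies in the adjoint. Testing [(x, y)] and [(f, g)] against it
    shows that the residual is orthogonal to itself. *)
Lemma biadjoint_seq Q x y : linear_relation Q -> adjoint (adjoint Q) (x, y) ->
  exists q : nat -> V * W, [/\ forall n, Q (q n),
    (q n).1 @[n --> \oo] --> x & (q n).2 @[n --> \oo] --> y].
Proof.
move=> Ql Qxy.
have [f [g [q [Qq qf qg orth]]]] := graph_projection x y Ql.
have Qfg := biadjoint_lim Qq qf qg.
have Qs : adjoint Q (y - g, - (x - f)).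
  move=> a b /orth /= /eqP; rewrite addr_eq0 => /eqP h.
  by rewrite innerNl h opprK.
have /= h1 := Qxy _ _ Qs; have /= h2 := Qfg _ _ Qs.
have h : inner (x - f) (x - f) + inner (y - g) (y - g) = 0.
  rewrite [X in _ + X]innerBl h1 h2 -innerBl innerNr; exact: subrr.
move/eqP: h; rewrite paddr_eq0 ?inner_ge0 // => /andP[].
move=> /eqP/inner_eq0 xf /eqP/inner_eq0 yg.
exists q; split=> //.
  by rewrite -[x](subrK f) xf add0r.
by rewrite -[y](subrK g) yg add0r.
Qed.

Local Notation modulus2 Q := (rel_mul (adjoint Q) (adjoint (adjoint Q))).

(** Orthogonality of the residual [(h - f, - g)] to [Q] says that [(g, h - f)] lies in the adjoint
    of [Q]. Thus [h] is in the range of [Q^* Q^** + 1]. *)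
Lemma modulus2_range Q h : linear_relation Q ->
  exists f, modulus2 Q (f, h - f).
Proof.
move=> Ql.
have [f [g [q [Qq qf qg orth]]]] := graph_projection h 0 Ql.
exists f, g; split; first exact: biadjoint_lim qf qg.
by move=> x y /orth /= /eqP; rewrite sub0r innerNl subr_eq0 => /eqP.
Qed.

Lemma rel_mul_linear (X : hilbertType C) (S : set (W * X)) (T : set (V * W)) :
  linear_relation S -> linear_relation T -> linear_relation (rel_mul S T).
Proof.
move=> /linear_subspaceP[S0 SP] /linear_subspaceP[T0 TP].
apply/linear_subspaceP; split; first by exists 0.
move=> a [x x'] [y y'] [g [Tg Sg]] [g' [Tg' Sg']].
by exists (a *: g + g'); split; [exact: TP Tg Tg'|exact: SP Sg Sg'].
Qed.

(** Both sides equal [inner g k] for the intermediate vectors [g] and [k] of the two pairs. *)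
Lemma modulus2_sym Q f f' h h' : modulus2 Q (f, f') -> modulus2 Q (h, h') ->
  inner f' h = inner f h'.
Proof.
move=> [g [/= fg gf]] [k [/= hk kh]].
have := hk _ _ gf; have := fg _ _ kh => /= <- /=.
by rewrite (inner_conj f') => <-; rewrite -inner_conj.
Qed.

End LinearRelations.

Lemma rel_shiftP (C : numClosedFieldType) (V : hilbertType C)
    (T : set (V * V)) (c : C) x x' :
  rel_shift T c (x, x') <-> T (x, x' - c *: x).
Proof.
split=> [[[a b] Tab [<- <-]]|Tx]; first by rewrite addrK.
by exists (x, x' - c *: x) => //=; rewrite subrK.
Qed.

Lemma rel_shift_linear (C : numClosedFieldType) (V : hilbertType C)
    (T : set (V * V)) (c : C) :
  linear_relation T -> linear_relation (rel_shift T c).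
Proof.
move=> /linear_subspaceP[T0 TP]; apply/linear_subspaceP; split.
  by apply/rel_shiftP; rewrite scaler0 subr0.
move=> a [x x'] [y y'] /rel_shiftP Tx /rel_shiftP Ty; apply/rel_shiftP.
have := TP a _ _ Tx Ty; congr (T (_, _)) => /=.
by rewrite scalerBr scalerDr opprD addrACA !scalerA (mulrC c).
Qed.

(** * Criteria for selfadjointness *)

Section Selfadjoint.
Variables (C : numClosedFieldType) (V : hilbertType C).

(** The last hypothesis says that [B + 1] is onto. An element [(k, k')] of the adjoint is compared
    with the element [(f, k + k' - f)] of [B]; the difference [u] has the form [(v, - v)], and
    surjectivity once more forces [v = 0]. *)
Lemma selfadjoint_of_range (B : set (V * V)) : linear_relation B ->
  (forall f f' h h', B (f, f') -> B (h, h') -> inner f' h = inner f h') ->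
  (forall h, exists f, B (f, h - f)) -> selfadjoint_relation B.
Proof.
move=> Bl Bsym Brange; split=> //.
have Bsub : B `<=` adjoint B.
  by move=> [f f'] Bf h h' Bh /=; exact: Bsym Bf Bh.
apply/seteqP; split=> // -[k k'] Bk.
have [f Bf] := Brange (k + k').
have /linear_subspaceP[_ AP] := adjoint_linear B.
have := AP (-1) _ _ (Bsub _ Bf) Bk.
set u := _ + _ => Bu.
(* Testing [u] against [(x, u.1 - x)] in [B] gives [- (u.1, x) = (u.1, u.1 - x)], that is,
   [(u.1, u.1) = 0]. *)
have [x Bx] := Brange u.1.
have u2 : u.2 = - u.1.
  rewrite /u /=; by rewrite !scaleN1r opprB [RHS]opprD opprK opprD addrA subrK.
have u10 : u.1 = 0.
  apply: inner_eq0; have := Bu _ _ Bx; rewrite u2 innerNl innerBr => /eqP.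
  rewrite -subr_eq0 /= => /eqP h; move: h.
  by move=> /eqP; rewrite -opprD oppr_eq0 addrC subrK => /eqP.
have kf : k = f.
  move: u10; rewrite /u /= scaleN1r => /eqP.
  by rewrite addrC subr_eq0 => /eqP.
have k'E : k' = k + k' - f by rewrite kf [f + k']addrC addrK.
by rewrite k'E {1}kf.
Qed.

Lemma rel_shift_selfadjoint (B : set (V * V)) (c : C) : c \is Num.real ->
  selfadjoint_relation B -> selfadjoint_relation (rel_shift B c).
Proof.
move=> cr [Bl BE].
have cJ : c^* = c by exact/CrealP.
have sym f f' h h' : rel_shift B c (f, f') -> B (h, h') ->
    inner f' h = inner f (h' + c *: h).
  move=> /rel_shiftP Bf Bh.
  have : adjoint B (f, f' - c *: f) by rewrite -BE.
  move=> /(_ _ _ Bh) /=; rewrite innerBl innerZl => /eqP.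
  by rewrite subr_eq => /eqP ->; rewrite innerDr innerZr cJ.
split; first exact: rel_shift_linear.
apply/seteqP; split=> [[f f'] Bf h h' /rel_shiftP Bh /=|[k k'] Bk].
  by rewrite (sym _ _ _ _ Bf Bh) subrK.
apply/rel_shiftP; rewrite BE => h h' Bh /=.
have /Bk /= : rel_shift B c (h, h' + c *: h) by apply/rel_shiftP; rewrite addrK.
rewrite innerBl innerZl => ->; rewrite innerDr /= innerZr cJ.
by rewrite addrK.
Qed.

End Selfadjoint.

(** * Semibounded forms *)

(** Polarization: real values at [a *: y + x] make [a * f y x + a^* * f x y] real, and [a = 1] and
    [a = 'i] together give the symmetry. Thus symmetry of a semibounded form, which [sform] does not
    demand, follows from the bound. *)
Lemma real_diagonal_hermitian (C : numClosedFieldType) (E : lmodType C)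
    (f : E -> E -> C) : bilinear_for *%R ((@Num.conj C) \; *%R) f ->
  (forall x, f x x \is Num.real) -> forall x y, f x y = (f y x)^*.
Proof.
move=> [fl fr] freal x y.
have fll a u v w : f (a *: u + v) w = a * f u w + f v w by exact: fl.
have frr a u v w : f w (a *: u + v) = a^* * f w u + f w v by exact: fr.
have key a : (a * f y x + a^* * f x y)^* = a * f y x + a^* * f x y.
  apply/CrealP.
  have -> : a * f y x + a^* * f x y =
      f (a *: y + x) (a *: y + x) - `|a| ^+ 2 * f y y - f x x.
    by rewrite fll !frr normCK; ring.
  by rewrite !rpredB ?rpredM ?rpredX ?normr_real ?freal.
have := key 1; rewrite conjC1 !mul1r rmorphD /= => h1.
have := key 'i; rewrite conjCi rmorphD !rmorphM rmorphN /= conjCi opprK => h2.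
have h3 : - (f y x)^* + (f x y)^* = f y x - f x y.
  apply: (mulfI (neq0Ci C)); rewrite mulrDr mulrBr mulrN -mulNr h2.
  by rewrite mulNr.
have h4 : (f x y)^* *+ 2 = f y x *+ 2.
  rewrite !mulr2n.
  have -> : (f x y)^* + (f x y)^* =
      ((f y x)^* + (f x y)^*) + (- (f y x)^* + (f x y)^*).
    by ring.
  by rewrite h1 h3; ring.
by rewrite -(pmulrnI (ltn0Sn 1) h4) conjCK.
Qed.

(** * Representing maps and the relations they define *)

Section FormRepresentation.
Variables (C : numClosedFieldType) (V : hilbertType C) (t : sform V) (c : C).
Hypothesis c_real : c \is Num.real.
Hypothesis C_complete : seq_complete C.
Hypothesis C_archi : (n.+1%:R : C)^-1 @[n --> \oo] --> (0 : C).
Hypothesis C_inf : nonneg_inf C.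

Section Existence.
Hypothesis t_ge : form_bounded_below t c.
Local Notation E := (subspace_type (form_dom_linear t)).

Definition shifted_form (x y : E) : C :=
  t (val x) (val y) - c * inner (val x) (val y).

Lemma shifted_form_bilinear :
  bilinear_for *%R ((@Num.conj C) \; *%R) shifted_form.
Proof.
split=> z a x y; rewrite /shifted_form linearP /=.
  rewrite form_linearl ?innerDl ?innerZl; try exact: subspace_typeP.
  by ring.
rewrite form_antilinearr ?innerDr ?innerZr; try exact: subspace_typeP.
by ring.
Qed.

Lemma shifted_form_ge0 x : 0 <= shifted_form x x.
Proof. by rewrite subr_ge0 inner_norm t_ge //; exact: subspace_typeP. Qed.

Lemma shifted_form_hermitian (x y : E) :
  shifted_form x y = (-1) ^+ false * (shifted_form y x)^*.
Proof.
rewrite mul1r; apply: real_diagonal_hermitian.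
  exact: shifted_form_bilinear.
by move=> z; rewrite ger0_real ?shifted_form_ge0.
Qed.

HB.instance Definition _ := @bilinear_isBilinear.Build C E E C
  *%R ((@Num.conj C) \; *%R) shifted_form shifted_form_bilinear.
HB.instance Definition _ := @isHermitianSesquilinear.Build C E
  false (@Num.conj C) shifted_form shifted_form_hermitian.

Lemma representing_map_exists :
  exists (K : hilbertType C) (Q : set (V * K)), representing_map t c Q.
Proof.
have [K [j [jl ji]]] := @completion_exists C E shifted_form shifted_form_ge0
  C_complete C_archi.
exists K, [set (val x, j x) | x in [set: E]]; split.
- split.
    apply/linear_subspaceP; split.
      exists 0 => //; rewrite linear0.
      by have := jl (-1) 0 0; rewrite scaler0 addr0 scaleN1r addNr => ->.
    move=> a _ _ [x _ <-] [y _ <-]; exists (a *: x + y) => //.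
    by rewrite linearP jl.
  by move=> f g g' [x _ [<- <-]] [y _ [/val_inj -> <-]].
- apply/seteqP; split=> [x [_ [y _ [<- _]]]|x Dx]; first exact: subspace_typeP.
  have [y <-] := subspace_type_ex (form_dom_linear t) Dx.
  by exists (j y), y.
- by move=> _ _ _ _ [x _ [<- <-]] [y _ [<- <-]]; rewrite ji.
Qed.

End Existence.

Variables (K : hilbertType C) (Q : set (V * K)).
Hypothesis QP : representing_map t c Q.

Let Q_lin : linear_relation Q. Proof. by have [[]] := QP. Qed.

Let Q_dom x : form_dom t x <-> exists y, Q (x, y).
Proof. by have [_ <- _] := QP. Qed.

Let QE x y qx qy : Q (x, qx) -> Q (y, qy) ->
  t x y = inner qx qy + c * inner x y.
Proof.
by have [_ _ QE] := QP; move=> Qx Qy; rewrite -(QE _ _ _ _ Qx Qy) subrK.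
Qed.

Let QB x y qx qy : Q (x, qx) -> Q (y, qy) -> Q (x - y, qx - qy).
Proof.
move=> Qx Qy; have /linear_subspaceP[_ QP'] := Q_lin.
have := QP' (-1) _ _ Qy Qx; congr (Q (_, _)) => /=;
by rewrite scaleN1r addrC.
Qed.

(** Since [t[x, y] = (qx, qy) + c (x, y)], the equation [t[x, y] = (x', y)] amounts to
    [(qx, qy) = (x' - c x, y)]. *)
Lemma form_repr_adjoint x qx x' : Q (x, qx) ->
  form_repr t x x' <-> adjoint Q (qx, x' - c *: x).
Proof.
move=> Qx; split=> [xx' y qy Qy /=|Qx' y /Q_dom[qy Qy]].
  rewrite innerBl innerZl -xx'; last by apply/Q_dom; exists qy.
  by rewrite (QE Qx Qy) addrK.
have /= := Qx' _ _ Qy; rewrite innerBl innerZl (QE Qx Qy) => /eqP.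
by rewrite subr_eq => /eqP ->.
Qed.

Lemma form_repr_modulus2 :
  [set xx | form_dom t xx.1 /\ form_repr t xx.1 xx.2] =
  rel_shift (rel_mul (adjoint Q) Q) c.
Proof.
apply/seteqP; split=> [[x x'] [/= /Q_dom[qx Qx] xx']|[x x']].
  by apply/rel_shiftP; exists qx; split=> //; exact/form_repr_adjoint.
move=> /rel_shiftP[qx [/= Qx Qx']]; split=> /=; first by apply/Q_dom; exists qx.
exact/form_repr_adjoint/Qx'.
Qed.

Lemma inner_diff_cvg0 (W : hilbertType C) (u : nat -> W) (x : W) :
  u @ \oo --> x ->
  inner (u nm.1 - u nm.2) (u nm.1 - u nm.2) @[nm --> (\oo, \oo)] --> (0 : C).
Proof.
move=> ux.
have d0 : u nm.1 - u nm.2 @[nm --> (\oo, \oo)] --> x - x.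
  by apply: cvgB; apply: cvg_comp ux; [exact: cvg_fst|exact: cvg_snd].
have n0 : `|u nm.1 - u nm.2| @[nm --> (\oo, \oo)] --> (`|x - x| : C).
  exact: cvg_norm.
rewrite subrr normr0 in n0.
have h : `|u nm.1 - u nm.2| * `|u nm.1 - u nm.2| @[nm --> (\oo, \oo)]
    --> (0 * 0 : C) by exact: cvgM.
by rewrite mulr0 in h; apply: cvg_ext h => nm; rewrite inner_norm expr2.
Qed.

(** For [q n] the image of [u n] under [Q], convergence [u ->_t x] means that [u] tends to [x] and
    [q] is Cauchy, so [(u n, q n)] tends to a point [(x, g)] of [Q^**]. Then [t[u n, y]] tends to
    [(g, qy) + c (x, y)], and condition (2) places [(g, x' - c x)] in [Q^*]. *)
Lemma form_limit_repr_modulus2 :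
  [set xx | form_limit_repr t xx.1 xx.2] =
  rel_shift (rel_mul (adjoint Q) (adjoint (adjoint Q))) c.
Proof.
apply/seteqP; split=> [[x x'] [u [[/= Du ux tu] ul]]|[x x']].
  have /choice[q Qq] : forall n, exists q, Q (u n, q) by move=> n; exact/Q_dom.
  have cq : inner (q nm.1 - q nm.2) (q nm.1 - q nm.2)
      @[nm --> (\oo, \oo)] --> (0 - c * 0 : C).
    have h : t (u nm.1 - u nm.2) (u nm.1 - u nm.2) -
        c * inner (u nm.1 - u nm.2) (u nm.1 - u nm.2)
        @[nm --> (\oo, \oo)] --> (0 - c * 0 : C).
      by apply: cvgB => //; apply: cvgMl_tmp; exact: (inner_diff_cvg0 ux).
    apply: cvg_ext h => nm.
    by rewrite (QE (QB (Qq _) (Qq _)) (QB (Qq _) (Qq _))) addrK.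
  rewrite mulr0 subr0 in cq.
  have qg := inner_cauchy_cvg cq.
  set g := lim (q @ \oo) in qg.
  apply/rel_shiftP; exists g; split=> /=.
    exact: (@biadjoint_lim _ _ _ _ (fun n => (u n, q n))).
  move=> y qy Qy /=.
  have h : inner (q n) qy @[n --> \oo] --> (inner x' y - c * inner x y : C).
    have Dy : form_dom t y by apply/Q_dom; exists qy.
    have h : t (u n) y - c * inner (u n) y @[n --> \oo]
        --> (inner x' y - c * inner x y : C).
      by apply: cvgB; [exact: ul|apply: cvgMl_tmp; exact: cvg_inner].
    by apply: cvg_ext h => n; rewrite (QE (Qq n) Qy) addrK.
  rewrite innerBl innerZl.
  apply: (@norm_cvg_unique C C _ _ _ _ h); exact: cvg_inner.
move=> /rel_shiftP[g [/= Qg Qx']].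
(* Conversely, a sequence in the graph of [Q] that tends to [(x, g)] has the required [u] as its
   first components. *)
have [q [Qq qx qg]] := biadjoint_seq C_archi C_inf Q_lin Qg.
have Qq' n : Q ((q n).1, (q n).2) by rewrite -surjective_pairing.
exists (fun n => (q n).1); split; first split=> //.
- by move=> n; apply/Q_dom; exists (q n).2.
- have h : inner ((q nm.1).2 - (q nm.2).2) ((q nm.1).2 - (q nm.2).2) +
      c * inner ((q nm.1).1 - (q nm.2).1) ((q nm.1).1 - (q nm.2).1)
      @[nm --> (\oo, \oo)] --> (0 + c * 0 : C).
    apply: cvgD; last apply: cvgMl_tmp.
      exact: (inner_diff_cvg0 qg).
    exact: (inner_diff_cvg0 qx).
  rewrite mulr0 addr0 in h; apply: cvg_ext h => nm.
  by rewrite (QE (QB (Qq' _) (Qq' _)) (QB (Qq' _) (Qq' _))).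
- move=> y /Q_dom[qy Qy].
  have h : inner (q n).2 qy + c * inner (q n).1 y @[n --> \oo]
      --> (inner g qy + c * inner x y : C).
    apply: cvgD; last apply: cvgMl_tmp; exact: cvg_inner.
  have -> : inner x' y = inner g qy + c * inner x y.
    by have /= <- := Qx' _ _ Qy; rewrite innerBl innerZl subrK.
  by apply: cvg_ext h => n; rewrite (QE (Qq' n) Qy).
Qed.

Lemma form_limit_repr_selfadjoint :
  selfadjoint_relation [set xx | form_limit_repr t xx.1 xx.2].
Proof.
rewrite form_limit_repr_modulus2; apply: rel_shift_selfadjoint => //.
apply: selfadjoint_of_range.
- by apply: rel_mul_linear; exact: adjoint_linear.
- exact: modulus2_sym.
- by move=> h; exact: modulus2_range.
Qed.

Lemma form_repr_sub_limit :
  [set xx | form_dom t xx.1 /\ form_repr t xx.1 xx.2] `<=`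
  [set xx | form_limit_repr t xx.1 xx.2].
Proof.
rewrite form_limit_repr_modulus2 form_repr_modulus2 => -[x x'].
move=> /rel_shiftP[g [/= Qg gx']]; apply/rel_shiftP; exists g; split=> //=.
exact: sub_biadjoint.
Qed.

Lemma form_repr_linear :
  linear_relation [set xx | form_dom t xx.1 /\ form_repr t xx.1 xx.2].
Proof.
rewrite form_repr_modulus2; apply: rel_shift_linear.
by apply: rel_mul_linear => //; exact: adjoint_linear.
Qed.

(** Along a graph sequence tending to [(x, g)], the value [t[u n, u n]] is [|q n|^2 + c |u n|^2],
    which tends to [|g|^2 + c |x|^2 = (x', x)]; the bound [m] survives the limit. *)
Lemma form_limit_repr_bounded_below m : form_bounded_below t m ->
  rel_bounded_below [set xx | form_limit_repr t xx.1 xx.2] m.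
Proof.
move=> tm x x'; rewrite form_limit_repr_modulus2 => /rel_shiftP[g [/= Qg Qx']].
have [q [Qq qx qg]] := biadjoint_seq C_archi C_inf Q_lin Qg.
have Qq' n : Q ((q n).1, (q n).2) by rewrite -surjective_pairing.
have normsq (W : hilbertType C) (u : nat -> W) w : u @ \oo --> w ->
    `|u n| ^+ 2 @[n --> \oo] --> (`|w| ^+ 2 : C).
  move=> uw; have uw' : `|u n| @[n --> \oo] --> (`|w| : C) by exact: cvg_norm.
  by rewrite expr2; exact: cvgM.
have -> : inner x' x = `|g| ^+ 2 + c * `|x| ^+ 2.
  rewrite -!inner_norm -[x'](subrK (c *: x)) innerDl innerZl; congr (_ + _).
  by have /= h := Qg _ _ Qx'; rewrite [LHS]inner_conj -h -inner_conj.
have hl : m * `|(q n).1| ^+ 2 @[n --> \oo] --> (m * `|x| ^+ 2 : C).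
  by apply: cvgMl_tmp; exact: (normsq _ _ _ qx).
have hr : `|(q n).2| ^+ 2 + c * `|(q n).1| ^+ 2 @[n --> \oo]
    --> (`|g| ^+ 2 + c * `|x| ^+ 2 : C).
  apply: cvgD; last apply: cvgMl_tmp.
    exact: (normsq _ _ _ qg).
  exact: (normsq _ _ _ qx).
apply: cvg_leC hl hr; apply: nearW => n.
rewrite -!inner_norm -(QE (Qq' n) (Qq' n)) inner_norm.
by apply: tm; apply/Q_dom; exists (q n).2.
Qed.

End FormRepresentation.

(** * The lower bound of a form *)

Section FormLowerBound.
Variables (R : realType) (V : hilbertType R[i]) (t : sform V).
Local Open Scope complex_scope.

(** At each nonzero [x] of the domain the Rayleigh quotient [t[x] / |x|^2] bounds every admissible
    [c] from above, hence also their supremum. *)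
Lemma form_lower_boundP : form_semibounded t ->
  form_bounded_below t (form_lower_bound t)%:C.
Proof.
move=> [c0 c0P] x Dx.
have bound (c : R) y : form_bounded_below t c%:C -> form_dom t y -> y != 0 ->
    c <= complex.Re (t y y / `|y| ^+ 2).
  move=> cP Dy y0; have y2 : 0 < `|y| ^+ 2 by rewrite exprn_gt0 ?normr_gt0.
  have : c%:C <= t y y / `|y| ^+ 2 by rewrite ler_pdivlMr ?cP.
  by rewrite lecE => /andP[].
have [x0|xn0] := eqVneq x 0.
  have := c0P _ Dx; rewrite x0 normr0 expr0n /= !mulr0; exact.
have x2 : 0 < `|x| ^+ 2 by rewrite exprn_gt0 ?normr_gt0.
rewrite -ler_pdivlMr //.
(* Comparison with [c0] shows that the quotient is real, which leaves an inequality between real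
   parts. *)
have : c0%:C <= t x x / `|x| ^+ 2 by rewrite ler_pdivlMr ?c0P.
rewrite !lecE /= => /andP[-> _] /=.
by apply: ge_sup => [|c cP]; [exists c0|exact: bound].
Qed.

Lemma form_bounded_belowW (c m : R) : c <= m ->
  form_bounded_below t m%:C -> form_bounded_below t c%:C.
Proof.
move=> cm tm x Dx; apply: le_trans (tm x Dx).
by rewrite ler_wpM2r ?exprn_ge0 // lecR.
Qed.

End FormLowerBound.

(** * Assembly of the statements (A), (B) and (C) *)

Local Open Scope complex_scope.

Theorem theorem6p1 (R : realType) (V : hilbertType R[i]) (t : sform V)
    (t_semibounded : form_semibounded t)
    (dom_t_neq0 : form_dom t <> [set 0]) :
  exists S A : set (V * V),
  [/\ (* (A) *)
      [/\ linear_relation S /\ rel_semibounded S,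
          rel_bounded_below S (form_lower_bound t)%:C,
          S.`1 `<=` form_dom t,
          (forall x x', S (x, x') -> form_repr t x x') &
          forall H : set (V * V), symmetric_relation H ->
            H.`1 `<=` form_dom t ->
            (forall x x', H (x, x') -> form_repr t x x') ->
            H `<=` S],
      (* (B) *)
      [/\ selfadjoint_relation A /\ rel_semibounded A,
          S `<=` A,
          rel_bounded_below A (form_lower_bound t)%:C,
          (forall x x', A (x, x') -> form_limit_repr t x x') &
          forall H : set (V * V), selfadjoint_relation H ->
            (forall x x', H (x, x') -> form_limit_repr t x x') ->
            H = A] &
      (* (C) *)
      symmetric_relation S /\
      forall c : R, c <= form_lower_bound t ->
        (exists (K : hilbertType R[i]) (Q : set (V * K)),
           representing_map t c%:C Q) /\
        forall (K : hilbertType R[i]) (Q : set (V * K)),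
          representing_map t c%:C Q ->
          S = rel_shift (rel_mul (adjoint Q) Q) c%:C /\
          A = rel_shift (rel_mul (adjoint Q) (adjoint (adjoint Q))) c%:C].
Proof.
have C_complete := @complex_seq_complete R.
have C_archi := @complex_archi R.
have C_inf := @complex_nonneg_inf R.
have c_real (c : R) : (c%:C : R[i]) \is Num.real by rewrite complex_real.
have tm := form_lower_boundP t_semibounded.
(* One representing map, for [c = m(t)], transfers the operator-theoretic properties to [S] and [A],
   which are themselves defined by conditions (1) and (2). *)
have [K [Q QP]] := representing_map_exists C_complete C_archi tm.
have Asa := form_limit_repr_selfadjoint (c_real _) C_archi C_inf QP.
have Am := form_limit_repr_bounded_below C_archi C_inf QP tm.
have SA := form_repr_sub_limit C_archi C_inf QP.
have S_lin := form_repr_linear QP.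
pose S := [set xx : V * V | form_dom t xx.1 /\ form_repr t xx.1 xx.2].
pose A := [set xx : V * V | form_limit_repr t xx.1 xx.2].
have AE : A = adjoint A := Asa.2.
have Sm : rel_bounded_below S (form_lower_bound t)%:C.
  by move=> x x' /SA; exact: Am.
have adjointS (T T' : set (V * V)) : T `<=` T' -> adjoint T' `<=` adjoint T.
  by move=> TT' [k k'] kk f g /TT'; exact: kk.
exists S, A; split.
- split.
  + by split=> //; exists (form_lower_bound t).
  + exact: Sm.
  + by move=> x [x' []].
  + by move=> x x' [].
  + move=> H _ Hdom Hrepr [x x'] Hx; split; last exact: Hrepr.
    by apply: Hdom; exists x'.
- split=> //.
  + by split=> //; exists (form_lower_bound t).
  + move=> H [_ HE] Hlim.
    have HA : H `<=` A by move=> [x x']; exact: Hlim.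
    apply/seteqP; split=> //.
    (* Taking adjoints reverses [H] included in [A], and both relations equal their adjoints. *)
    by rewrite AE HE; exact: adjointS.
- split.
    (* Symmetry of [S] comes from [A]: [S] lies in [A = A^*], which lies in [S^*]. *)
    split=> // xx Sxx; apply: (adjointS _ _ SA).
    by rewrite -AE; exact: SA.
  move=> c cm; split.
    apply: representing_map_exists => //.
    exact: form_bounded_belowW cm tm.
  move=> K' Q' Q'P; split; first exact: form_repr_modulus2.
  exact: form_limit_repr_modulus2.
Qed.
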